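(* Let $n,d\ge1$ be integers. The following hold. (i) If $n\ge d$, then for every $x_1,\dots,x_n\in\mathbb R^d$, $$\log\mathcal S_d^{\log}(x_1,\dots,x_n)\le\log\Big(\sum_{\ell=0}^d\binom n\ell\Big)\le d\log\Big(\frac{en}{d}\Big).$$ (ii) If $d=1$, $n\ge2$, and $x_1,\dots,x_n\in\mathbb R$ are nonzero, then $$\log\mathcal S_1^{\log}(x_1,\dots,x_n)\ge\tfrac12\log n.$$ More generally, for arbitrary $d\ge1$, assume that $d$ divides $n$ and that $x_1,\dots,x_n\in\mathbb R^d$ can be partitioned into $d$ groups of size $n/d$ such that all vectors in the $j$-th group are nonzero multiples of a common vector $u_j$, where $u_1,\dots,u_d\in\mathbb R^d$ are linearly independent. Then $$\log\mathcal S_d^{\log}(x_1,\dots,x_n)\ge\frac d2\log\Big(\frac nd\Big).$$ (iii) For any $d\ge1$, if $d$ divides $n$, then $$\sup_{x_1',\dots,x_n'\in\mathbb R^d}\log\mathcal S_d^{\log}(x_1',\dots,x_n')\ge d\log\Big(\frac nd+1\Big).$$ (iv) For any $n\ge d\ge1$, if $x_1,\dots,x_n\in\mathbb R^d$ are in general position, then $$\log\mathcal S_d^{\log}(x_1,\dots,x_n)\ge\log\Big(2\sum_{\ell=0}^{d-1}\binom{n-1}{\ell}\Big).$$ In particular, under the general position assumption, if $d\ge2$, then $$\log\mathcal S_d^{\log}(x_1,\dots,x_n)\ge(d-1)\log\Big(\frac{n-1}{d-1}\Big).$$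
   Context: $\sigma(t)=1/(1+e^{-t})$. The logistic Shtarkov sum of $x_1,\dots,x_n\in\mathbb R^d$ is $$\mathcal S_d^{\log}(x_1,\dots,x_n)=\sum_{\varepsilon\in\{-1,1\}^n}\ \sup_{\theta\in\mathbb R^d}\ \prod_{i=1}^n\sigma(\varepsilon_i\langle x_i,\theta\rangle).$$ The vectors $x_1,\dots,x_n\in\mathbb R^d$ are in general position if every subset of them of size at most $d$ is linearly independent. *)

(* Defs.v *)
From HB Require Import structures.
From mathcomp Require Import all_boot all_order all_algebra.
From mathcomp Require Import all_classical all_reals all_analysis.

Set Implicit Arguments.
Unset Strict Implicit.
Unset Printing Implicit Defensive.

Import Order.TTheory GRing.Theory Num.Theory.
Local Open Scope ring_scope.

Definition sigmoid (R : realType) (t : R) : R := 1 / (1 + expR (- t)).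

Definition dotp (R : realType) (d : nat) (u v : 'rV[R]_d) : R :=
  \sum_(k < d) u 0 k * v 0 k.

(* A sign vector is encoded by e : {ffun 'I_n -> bool}, with i-th sign
   (-1) ^+ e i. The products lie in ]0, 1], so the real-valued sup is the
   genuine supremum. *)
Definition logistic_shtarkov (R : realType) (n d : nat)
    (x : 'I_n -> 'rV[R]_d) : R :=
  \sum_(e : {ffun 'I_n -> bool})
    sup (range (fun theta : 'rV[R]_d =>
      \prod_(i < n) sigmoid ((-1) ^+ e i * dotp (x i) theta))).

(* Subsets are subsets of indices: a repeated vector counts twice, hence is
   linearly dependent as soon as 2 <= d. *)
Definition general_position (R : realType) (n d : nat)
    (x : 'I_n -> 'rV[R]_d) : Prop :=
  forall A : {set 'I_n}, (#|A| <= d)%N -> free [seq x i | i in A].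

(* Main.v *)
(* (i) Writing sigma(t) as the probability that a random threshold is at most t, and
   fixing thresholds one coordinate at a time without decreasing the sum, bounds the
   Shtarkov sum by the number of sign patterns of (<x_i, theta> - c_i)_i. Such a
   family of patterns shatters no set of more than d indices, because of a linear
   dependency, so Pajor's form of the Sauer-Shelah lemma applies.
   (ii) Choosing theta along a dual basis makes the sum dominate a product of
   one-dimensional sums. In dimension one, group the sign patterns by the number k of
   minus signs and choose theta so that the expected number is k. Newton's
   inequalities show that the probability of exactly k minus signs is then at least
   b(n,k) = 'C(n,k) k^k (n-k)^(n-k) / n^n, and
   b(n,k) >= sqrt n * w_k * w_(n-k) for w_k = 'C(2k,k) / 4^k, whose convolution
   square is constantly 1.
   (iii) In each group take coefficients of widely separated scales.
   (iv) Each realizable strict sign pattern contributes 1. Under general position,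
   every set of fewer than d indices avoiding a fixed index i0 is strongly shattered
   by the realizable patterns with a plus sign at i0; the dual of Pajor's lemma
   bounds their number from below, and negation doubles it. *)

Require Import Defs.
From HB Require Import structures.
From mathcomp Require Import all_boot all_order all_algebra.
From mathcomp Require Import all_classical all_reals all_analysis.
From mathcomp Require Import ring lra zify.

Set Implicit Arguments.
Unset Strict Implicit.
Unset Printing Implicit Defensive.

Import Order.TTheory GRing.Theory Num.Theory.
Local Open Scope ring_scope.

(** * Bounds on the logistic function and on products of its values *)

Section sigmoid.
Context {R : realType}.
Implicit Types t u : R.

Let den_gt0 t : 0 < 1 + expR (- t).
Proof. by rewrite addr_gt0 ?expR_gt0. Qed.

Lemma sigmoid_gt0 t : 0 < sigmoid t.
Proof. by rewrite /sigmoid divr_gt0. Qed.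

Lemma sigmoidN t : sigmoid (- t) = 1 - sigmoid t.
Proof.
rewrite /sigmoid opprK expRN.
have e0 := expR_gt0 t.
by field; rewrite !gt_eqF ?addr_gt0.
Qed.

Lemma sigmoid_lt1 t : sigmoid t < 1.
Proof. by rewrite -subr_gt0 -sigmoidN sigmoid_gt0. Qed.

Lemma le_sigmoid t u : (sigmoid t <= sigmoid u) = (t <= u).
Proof. by rewrite /sigmoid !div1r lef_pV2 ?posrE// lerD2l ler_expR lerN2. Qed.

Lemma sigmoid_logit (p : R) : 0 < p -> p < 1 -> sigmoid (ln (p / (1 - p))) = p.
Proof.
move=> p0 p1; have q0 : 0 < 1 - p by rewrite subr_gt0.
rewrite /sigmoid expRN lnK ?posrE ?divr_gt0//.
have -> : 1 + (p / (1 - p))^-1 = p^-1 by rewrite invf_div; field; rewrite gt_eqF.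
by rewrite div1r invrK.
Qed.

Lemma sigmoid_sign (b : bool) t :
  sigmoid ((-1) ^+ b * t) = if b then 1 - sigmoid t else sigmoid t.
Proof. by case: b; rewrite ?expr1 ?expr0 ?mulN1r ?mul1r ?sigmoidN. Qed.

Import numFieldNormedType.Exports.

Lemma continuous_sigmoid : continuous (fun t : R => sigmoid t).
Proof.
move=> t; rewrite /sigmoid; under [X in continuous_at _ X]eq_fun do rewrite div1r.
apply: (@continuousV R R (fun x : R => 1 + expR (- x))); first by rewrite gt_eqF.
apply: (@continuousD R R^o R (fun=> 1) (fun x : R => expR (- x)) t); first exact: cvg_cst.
apply: (@continuous_comp _ _ _ (fun x : R => - x) expR); first exact: opp_continuous.
exact: continuous_expR.
Qed.

Lemma expRN_le_inv t : 0 < t -> expR (- t) <= t^-1.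
Proof.
move=> t0; rewrite expRN lef_pV2 ?posrE ?expR_gt0//.
by apply: le_trans (expR_ge1Dx t); rewrite lerDr.
Qed.

(** This is [1 + v <= exp v] at [v = exp (- t)]; in this form a product of sigmoids is bounded by
    the exponential of a single sum. *)
Lemma sigmoid_ge_expR t : expR (- expR (- t)) <= sigmoid t.
Proof.
by rewrite /sigmoid div1r expRN lef_pV2 ?posrE ?expR_gt0// expR_ge1Dx.
Qed.

(** From [1 + exp (- t) <= 2 exp |t|]; the bound is close to 1/2 near the origin. *)
Lemma sigmoid_ge_half t : expR (- `|t|) / 2 <= sigmoid t.
Proof.
have h u : - u <= `|t| -> expR (- `|t|) / 2 <= sigmoid u.
  move=> ut; rewrite /sigmoid div1r [expR (- `|t|)]expRN -invfM lef_pV2 ?posrE ?mulr_gt0 ?expR_gt0//.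
  by rewrite mulrDr mulr1 lerD// ?ler_expR// -expR0 ler_expR.
by apply: h; rewrite -normrN ler_norm.
Qed.

(** The product is at least [exp (- sum_i exp (- a i t))], hence at least [1 - (sum_i 1 / a i) / t].
    This makes likelihoods tend to 1 along a ray. *)
Lemma prod_sigmoid_ge (I : finType) (a : I -> R) (eta : R) :
  (forall i, 0 < a i) -> 0 < eta ->
  exists2 T, 0 < T & forall t, T <= t -> 1 - eta <= \prod_i sigmoid (a i * t).
Proof.
move=> a0 eta0; set s := \sum_i (a i)^-1.
have s0 : 0 <= s by rewrite sumr_ge0// => i _; rewrite invr_ge0 ltW.
(* The [+ 1] keeps the witness positive even when [I] is empty. *)
exists (s / eta + 1); first by rewrite ltr_wpDl// divr_ge0// ltW.
move=> t tT; have t0 : 0 < t.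
  by apply: lt_le_trans tT; rewrite ltr_wpDl// divr_ge0// ltW.
apply: (@le_trans _ _ (\prod_i expR (- expR (- (a i * t))))); last first.
  by apply: ler_prod => i _; rewrite expR_ge0 sigmoid_ge_expR.
rewrite -expR_sum sumrN; apply: le_trans (expR_ge1Dx _); rewrite lerD2l lerN2.
apply: (@le_trans _ _ (s / t)).
  rewrite /s mulr_suml; apply: ler_sum => i _.
  by rewrite -invfM expRN_le_inv// mulr_gt0.
rewrite ler_pdivrMr// mulrC -ler_pdivrMr//.
by apply: le_trans tT; rewrite lerDl.
Qed.

(** Transfers a lower bound on the product to each of its factors. *)
Lemma prod_sigmoid_le (I : finType) (F : I -> R) j :
  \prod_i sigmoid (F i) <= sigmoid (F j).
Proof.
rewrite (bigD1 j)//= ler_piMr//; first exact/ltW/sigmoid_gt0.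
apply: prodr_ile1 => i _.
by rewrite ltW ?sigmoid_gt0// ltW// sigmoid_lt1.
Qed.

End sigmoid.

(** * Likelihoods and their suprema *)

Section likelihood.
Context {R : realType} {n d : nat}.
Implicit Types (x : 'I_n -> 'rV[R]_d) (e : {ffun 'I_n -> bool}).

Definition likelihood x e (theta : 'rV[R]_d) : R :=
  \prod_(i < n) sigmoid ((-1) ^+ e i * dotp (x i) theta).

Lemma likelihood_gt0 x e theta : 0 < likelihood x e theta.
Proof. by apply: prodr_gt0 => i _; exact: sigmoid_gt0. Qed.

Lemma has_sup_likelihood x e : has_sup (range (likelihood x e)).
Proof.
split; first by exists (likelihood x e 0), 0.
exists 1 => _ [theta _ <-]; apply: prodr_ile1 => i _.
by rewrite ltW ?sigmoid_gt0// ltW// sigmoid_lt1.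
Qed.

Lemma likelihood_le_sup x e theta :
  likelihood x e theta <= sup (range (likelihood x e)).
Proof. by apply: sup_upper_bound; [exact: has_sup_likelihood|exists theta]. Qed.

Lemma shtarkov_ge x (theta : {ffun 'I_n -> bool} -> 'rV[R]_d) :
  \sum_e likelihood x e (theta e) <= logistic_shtarkov x.
Proof. by apply: ler_sum => e _; exact: likelihood_le_sup. Qed.

Lemma shtarkov_gt0 x : 0 < logistic_shtarkov x.
Proof.
apply: lt_le_trans (shtarkov_ge x (fun=> 0)).
rewrite (bigD1 [ffun=> false])//= ltr_wpDr ?likelihood_gt0//.
by apply: sumr_ge0 => e _; rewrite ltW ?likelihood_gt0.
Qed.

(** Suprema need not be attained; near-maximizers, each losing an equal share of [eps], are
    enough. *)
Lemma shtarkov_le x (C : R) :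
  (forall theta : {ffun 'I_n -> bool} -> 'rV[R]_d,
    \sum_e likelihood x e (theta e) <= C) -> logistic_shtarkov x <= C.
Proof.
move=> H; apply/ler_addgt0Pr => eps eps0.
pose N : R := #|{ffun 'I_n -> bool}|%:R.
have N0 : 0 < N by rewrite ltr0n card_ffun card_bool expn_gt0.
have /choice [theta Htheta] (e : {ffun 'I_n -> bool}) : exists theta,
    sup (range (likelihood x e)) <= likelihood x e theta + eps / N.
  have [_ [theta _ <-] /ltW] :=
    sup_adherent (divr_gt0 eps0 N0) (has_sup_likelihood x e).
  by rewrite lerBlDr; exists theta.
apply: le_trans (_ : \sum_e (likelihood x e (theta e) + eps / N) <= _).
  by apply: ler_sum => e _; exact: Htheta.
rewrite big_split/= sumr_const -[_ *+ _]mulr_natr -/N divfK ?gt_eqF//.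
by rewrite lerD2r.
Qed.

Lemma dotpZr (u v : 'rV[R]_d) a : dotp u (a *: v) = a * dotp u v.
Proof. by rewrite mulr_sumr; apply: eq_bigr => k _; rewrite mxE mulrCA. Qed.

Lemma dotpZl (u v : 'rV[R]_d) a : dotp (a *: u) v = a * dotp u v.
Proof. by rewrite mulr_sumr; apply: eq_bigr => k _; rewrite mxE mulrA. Qed.

Lemma dotpDr (u v w : 'rV[R]_d) : dotp u (v + w) = dotp u v + dotp u w.
Proof. by rewrite -big_split; apply: eq_bigr => k _; rewrite mxE mulrDr. Qed.

Lemma dotp0r (u : 'rV[R]_d) : dotp u 0 = 0.
Proof. by apply: big1 => k _; rewrite mxE mulr0. Qed.

Lemma dotp_sumr (I : finType) (u : 'rV[R]_d) (v : I -> 'rV[R]_d) :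
  dotp u (\sum_i v i) = \sum_i dotp u (v i).
Proof. exact: (big_morph (dotp u) (dotpDr u) (dotp0r u)). Qed.

(** Dilating [theta] pushes every factor towards 1. *)
Lemma sup_likelihood_ge1 x e theta :
  (forall i, 0 < (-1) ^+ e i * dotp (x i) theta) ->
  1 <= sup (range (likelihood x e)).
Proof.
move=> H; apply/ler_addgt0Pr => eta eta0.
have [T _ /(_ T (lexx _)) HT] := prod_sigmoid_ge H eta0.
rewrite -lerBlDr; apply: le_trans (likelihood_le_sup x e (T *: theta)).
apply: le_trans HT _; rewrite le_eqVlt; apply/orP/or_introl/eqP.
by apply: eq_bigr => i _; rewrite dotpZr mulrCA mulrC.
Qed.

End likelihood.

(** A matrix with independent rows has a right inverse [B]; applied to the prescribed values it
    gives [v]. *)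
Lemma dual_family (R : realType) (I : finType) (d : nat) (x : I -> 'rV[R]_d)
    (A : pred I) (tau : I -> R) :
  free [seq x i | i in A] -> exists v, forall i, A i -> dotp (x i) v = tau i.
Proof.
move=> freeA.
pose M := \matrix_(k < #|A|) x (enum_val k).
have /row_freeP [B MB] : row_free M.
  apply: inj_row_free => v vM.
  have sz : size [seq x i | i in A] == #|A| by rewrite size_image.
  have /(@freeP _ _ _ (Tuple sz)) /(_ (v 0)) H : free (Tuple sz) by [].
  apply/rowP => k; rewrite mxE; apply: H.
  rewrite -[RHS]vM mulmx_sum_row; apply: eq_bigr => l _; rewrite rowK/=.
  by congr (_ *: _); rewrite (nth_map (enum_val l)) -?enum_val_nth// -cardE.
pose t : 'cV[R]_#|A| := \col_k tau (enum_val k).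
exists (B *m t)^T => i Ai.
have iA : i \in A by [].
have : (M *m (B *m t)) (enum_rank_in iA i) 0 = tau i.
  by rewrite mulmxA MB mul1mx mxE enum_rankK_in.
rewrite mxE => <-; apply: eq_bigr => k _; rewrite !mxE enum_rankK_in//.
Qed.

(** * Shattering, Pajor's inequality and its dual *)

Section shattering.
Context {I : finType}.
Implicit Types (F : {set {ffun I -> bool}}) (S : {set I}).

Definition shatters F S :=
  [forall f : {ffun I -> bool}, exists g in F, [forall i in S, g i == f i]].

Lemma shattersP F S :
  reflect (forall f : I -> bool, exists2 g, g \in F & {in S, g =1 f})
          (shatters F S).
Proof.
apply: (iffP forallP) => [H f|H f].
  have /exists_inP [g gF /forall_inP gf] := H [ffun i => f i].
  by exists g => // i iS; have := gf _ iS; rewrite ffunE => /eqP.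
have [g gF gf] := H f; apply/exists_inP; exists g => //.
by apply/forall_inP => i iS; rewrite gf.
Qed.

Lemma shatters_sub F F' S : F \subset F' -> shatters F S -> shatters F' S.
Proof.
move=> /fintype.subsetP FF' /shattersP H; apply/shattersP => f.
by have [g gF gf] := H f; exists g => //; exact: FF'.
Qed.

(* Pajor's strengthening of the Sauer-Shelah lemma. Split F according to a
   coordinate i that is not constant on F: a set shattered by both halves
   remains shattered after adding i. *)
Lemma card_le_shattered F : (#|F| <= #|[set S | shatters F S]|)%N.
Proof.
elim: {F}_.+1 {-2}F (ltnSn #|F|) => // m IH F; rewrite ltnS => Fm.
have [F1|/card_gt1P [f [g [fF gF fg]]]] := leqP #|F| 1.
  have [->|[f fF]] := set_0Vmem F; first by rewrite cards0.
  apply: (leq_trans F1); rewrite card_gt0; apply/set0Pn; exists finset.set0.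
  by rewrite inE; apply/shattersP => h; exists f => // i; rewrite inE.
have [i fgi] : exists i, f i != g i.
  by apply/existsP; apply: contraR fg; rewrite negb_exists => /forallP H;
    apply/eqP/ffunP => i; have := H i; rewrite negbK => /eqP.
pose Fb b := [set h in F | h i == b].
have Fbs b : Fb b \subset F by apply/fintype.subsetP => h; rewrite inE => /andP[].
have FbE b : F :\: Fb b = Fb (~~ b).
  by apply/setP => h; rewrite !inE; case: (h \in F) (h i) b => [] [] [].
have cardF : #|F| = (#|Fb true| + #|Fb false|)%N.
  by rewrite -(cardsID (Fb true) F) FbE (finset.setIidPr (Fbs _)).
(* [f] and [g] lie in different halves, so both halves are strictly smaller than [F]. *)
have Fb0 b : (0 < #|Fb b|)%N.
  apply/card_gt0P; exists (if f i == b then f else g).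
  by case: ifPn => fb; rewrite inE ?fF ?gF//=; case: (f i) (g i) b fgi fb => [] [] [].
have IHb b : (#|Fb b| <= #|[set S | shatters (Fb b) S]|)%N.
  by apply: IH; move: Fm (Fb0 true) (Fb0 false); rewrite cardF; case: b; lia.
pose Sh b := [set S | shatters (Fb b) S].
have notin b S : S \in Sh b -> i \notin S.
  rewrite inE => /shattersP /(_ (fun=> ~~ b)) [h].
  rewrite inE => /andP[_ /eqP hb] hS; apply/negP => /hS; rewrite hb.
  by case: b {hS hb}.
(* The two counts add up to union plus intersection. Sets in the union avoid [i]; those in the
   intersection give new shattered sets once [i] is added. *)
rewrite cardF (leq_trans (leq_add (IHb _) (IHb _)))// -cardsUI.
have inj : {in Sh true :&: Sh false &, injective (fun S => i |: S)}.
  move=> S S' /finset.setIP[/notin iS _] /finset.setIP[/notin iS' _] /(congr1 (fun S => S :\ i)).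
  by rewrite !setU1K.
rewrite -(card_in_imset inj).
rewrite -cardsUI [X in (_ + #|pred_of_set X|)%N](_ : _ = finset.set0) ?cards0 ?addn0; last first.
  apply/setP => S; rewrite finset.in_set0; apply/negP => /finset.setIP[/finset.setUP SS /imsetP[S' _ SE]].
  by have : i \notin S by [case: SS => /notin]; rewrite SE !inE eqxx.
apply: subset_leq_card; apply/fintype.subsetP => S.
rewrite !inE => /orP[/orP[]|/imsetP[S' /finset.setIP[]]]; try exact: shatters_sub.
rewrite !inE => /shattersP Ht /shattersP Hf ->; apply/shattersP => h.
have [k kF kS] : exists2 k, k \in Fb (h i) & {in S', k =1 h}.
  by case: (h i); [exact: Ht|exact: Hf].
exists k; first exact: (fintype.subsetP (Fbs (h i))).
move=> j; rewrite !inE => /orP[/eqP->|]; last exact: kS.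
by move: kF; rewrite inE => /andP[_ /eqP].
Qed.

(** [F] contains a whole subcube with free directions [S]: one choice of values off [S] serves all
    patterns on [S], whereas in [shatters] it may vary. *)
Definition strongly_shatters F S :=
  exists f : I -> bool, forall g, {in ~: S, g =1 f} -> finfun g \in F.

(* S is strongly shattered by F unless the complement of S is shattered by the
   complement of F; the claim is thus dual to Pajor's inequality. *)
Lemma card_ge_strongly_shattered F (SS : {set {set I}}) :
  (forall S, S \in SS -> strongly_shatters F S) -> (#|SS| <= #|F|)%N.
Proof.
move=> H.
have sub : [set S | shatters (~: F) S] \subset ~: [set ~: S | S in SS].
  apply/fintype.subsetP => S; rewrite !inE => /shattersP HS.
  apply/negP => /imsetP[S' /H [f Hf] SE].
  have [g gF gf] := HS f; move: gF; rewrite inE => /negP; apply.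
  have -> : g = finfun g by apply/ffunP => i; rewrite ffunE.
  by apply: Hf => i iS; apply: gf; rewrite SE.
have := leq_trans (card_le_shattered (~: F)) (subset_leq_card sub).
(* Complements are counted on both sides: [2^|I| - |F| <= 2^|I| - |SS|]. *)
have e1 : (#|~: F| + #|F| = 2 ^ #|I|)%N by rewrite addnC cardsC card_ffun card_bool.
have e2 : (#|~: [set ~: S | S in SS]| + #|SS| = 2 ^ #|I|)%N.
  rewrite addnC -(card_imset (mem SS) (can_inj (@finset.setCK I))) cardsC.
  by rewrite -cardsT -powersetT card_powerset cardsT.
lia.
Qed.

End shattering.

(** * Estimates for binomial sums *)

Lemma card_small_subsets (T : finType) (B : {set T}) (d : nat) :
  #|[set A : {set T} | A \subset B & (#|A| < d)%N]| = (\sum_(l < d) 'C(#|B|, l))%N.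
Proof.
elim: d => [|d IH].
  by rewrite big_ord0; apply/eqP; rewrite cards_eq0; apply/eqP/setP => A; rewrite !inE andbF.
rewrite big_ord_recr/= -IH -cards_draws -cardsUI.
rewrite [X in (_ = _ + #|pred_of_set X|)%N](_ : _ = finset.set0) ?cards0 ?addn0; last first.
  by apply/setP => A; rewrite !inE; case: (A \subset B) => //=; case: ltngtP.
apply: eq_card => A; rewrite !inE ltnS leq_eqVlt.
by case: (A \subset B) => //=; rewrite orbC.
Qed.

(** With [y = d / n <= 1], multiplying by [y^d <= y^l] bounds the sum by
    [(1 + y)^n <= exp (n y) = exp d]. *)
Lemma sum_binom_le (R : realType) (n d : nat) : (0 < d <= n)%N ->
  (\sum_(l < d.+1) 'C(n, l))%N%:R <= (expR 1 * n%:R / d%:R) ^+ d :> R.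
Proof.
move=> /andP[d0 dn].
have n0 : (0 < n)%N by exact: leq_trans dn.
have dR : 0 < d%:R :> R by rewrite ltr0n.
have nR : 0 < n%:R :> R by rewrite ltr0n.
pose y : R := d%:R / n%:R.
have y0 : 0 < y by rewrite divr_gt0.
have y1 : y <= 1 by rewrite ler_pdivrMr// mul1r ler_nat.
have yE : n%:R / d%:R = y^-1 by rewrite invf_div.
rewrite -mulrA yE exprMn exprVn ler_pdivlMr ?exprn_gt0//.
apply: (@le_trans _ _ ((1 + y) ^+ n)); last first.
  have -> : expR 1 ^+ d = (expR y ^+ n : R).
    by rewrite -!expRM_natl; congr expR; rewrite mulr1 mulrCA divff ?mulr1 ?gt_eqF.
  by rewrite lerXn2r ?nnegrE ?expR_ge0 ?expR_ge1Dx// addr_ge0// ltW.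
rewrite exprDn natr_sum mulr_suml.
rewrite (big_ord_widen n.+1 (fun l => 'C(n, l)%:R * y ^+ d))//.
rewrite [leRHS](bigID (fun l : 'I_n.+1 => (l < d.+1)%N))/= ler_wpDr//.
  by apply: sumr_ge0 => l _; rewrite expr1n mul1r mulrn_wge0// exprn_ge0// ltW.
apply: ler_sum => l ld; rewrite expr1n mul1r -[leRHS]mulr_natl ler_wpM2l//.
by rewrite ler_wiXn2l// ltW.
Qed.

(** Induction through [(d + 1) C(n + 1, d + 1) = (n + 1) C(n, d)]; what remains is
    [d (n + 1) <= (d + 1) n]. *)
Lemma expn_le_binom (n d : nat) : (d <= n)%N -> (n ^ d <= 'C(n, d) * d ^ d)%N.
Proof.
elim: d n => [|d IH] [|n]//; rewrite ltnS => dn.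
have [->|d0] := posnP d; first by rewrite bin1 expn1 expn1 muln1.
rewrite -(@leq_pmul2l (d ^ d)) ?expn_gt0 ?d0//.
have -> : (d ^ d * ('C(n.+1, d.+1) * d.+1 ^ d.+1) =
           n.+1 * d.+1 ^ d * ('C(n, d) * d ^ d))%N.
  have E := mul_bin_diag n.+1 d; rewrite /= in E.
  transitivity (d ^ d * d.+1 ^ d * (d.+1 * 'C(n.+1, d.+1)))%N.
    by rewrite expnS; ring.
  by rewrite -E; ring.
apply: leq_trans (leq_mul (leqnn _) (IH _ dn)).
rewrite expnS mulnCA -mulnA leq_mul2l/= -!expnMn leq_exp2r//; nia.
Qed.

(** * Replacing probabilities by deterministic thresholds *)

Section threshold.
Context {R : realType}.

(** A discrete substitute for Lebesgue measure on [[lo, 1]], as a list of pairs (mass, position):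
    the mass of each gap between consecutive points sits at its right end. *)
Lemma exists_weights (lo : R) (s : seq R) :
  path <%R lo s -> all (< 1) (lo :: s) ->
  exists ws : seq (R * R),
    [/\ \sum_(x <- ws) x.1 = 1 - lo,
        {in ws, forall x, 0 <= x.1 /\ lo < x.2 < 1} &
        {in s, forall p, \sum_(x <- ws | x.2 <= p) x.1 = p - lo}].
Proof.
elim: s lo => [|p s IH] lo /=.
  (* The last gap puts its mass at the midpoint, so that every position stays below 1 and has a
     logit. *)
  move=> _ /andP[lo1 _]; exists [:: (1 - lo, (lo + 1) / 2)]; split => //.
    by rewrite big_seq1.
  by move=> x; rewrite inE => /eqP ->/=; split; [lra|apply/andP; split; lra].
move=> /andP[lop ps] /andP[lo1 /andP[p1 s1]].
have [|ws [ws1 ws2 ws3]] := IH p ps; first by rewrite /= p1.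
exists ((p - lo, p) :: ws); split.
- by rewrite big_cons ws1/=; ring.
- move=> x; rewrite inE => /orP[/eqP ->/=|/ws2[? /andP[px ?]]].
    by rewrite subr_ge0 ltW// lop p1.
  by split=> //; rewrite (lt_trans lop px).
move=> q; rewrite inE big_cons => /orP[/eqP ->/=|qs].
  rewrite lexx big1_seq ?addr0// => x /andP[xp /ws2[_ /andP[]]].
  by rewrite ltNge xp.
have pq : p < q by move: ps; rewrite lt_path_sortedE => /andP[/allP /(_ _ qs)].
by rewrite /= ltW// ws3//; ring.
Qed.

(* Integrating [u <= p j] over u in [0, 1] gives p j; the integral is replaced
   by a finite average over the values of p. *)
Lemma exists_threshold (J : finType) (p a : J -> R) (b : J -> bool) :
  (forall j, 0 < p j < 1) -> (forall j, 0 <= a j) ->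
  exists2 u, 0 < u < 1 &
    \sum_j a j * (if b j then 1 - p j else p j) <=
    \sum_j a j * ((u <= p j) == ~~ b j)%:R.
Proof.
move=> p01 a0.
pose s := sort <=%R (undup [seq p j | j : J]).
have ps j : p j \in s by rewrite mem_sort mem_undup map_f// mem_enum.
have s01 x : x \in s -> 0 < x < 1.
  by rewrite mem_sort mem_undup => /mapP[j _ ->].
have [||ws [ws1 ws2 ws3]] := @exists_weights 0 s.
- rewrite lt_path_sortedE sort_lt_sorted undup_uniq andbT.
  by apply/allP => x /s01 /andP[].
- by rewrite /= ltr01; apply/allP => x /s01 /andP[].
pose G u := \sum_j a j * ((u <= p j) == ~~ b j)%:R : R.
have GE : \sum_j a j * (if b j then 1 - p j else p j) = \sum_(x <- ws) x.1 * G x.2.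
  rewrite /G; under [RHS]eq_bigr do rewrite mulr_sumr.
  rewrite exchange_big/=; apply: eq_bigr => j _.
  under eq_bigr do rewrite mulrCA; rewrite -mulr_sumr; congr (_ * _).
  have wj : \sum_(x <- ws) x.1 * (x.2 <= p j)%R%:R = p j.
    rewrite -[RHS]subr0 -(ws3 _ (ps j)) [RHS]big_mkcond/=; apply: eq_bigr => x _.
    by case: ifP => _; rewrite ?mulr1 ?mulr0.
  case: (b j); last by rewrite -[LHS]wj; apply: eq_bigr => x _; case: (_ <= _).
  have w1 : 1 = \sum_(x <- ws) x.1 by rewrite ws1 subr0.
  rewrite -[in LHS]wj {1}w1 -sumrB; apply: eq_bigr => x _.
  by case: (_ <= _); rewrite /= ?mulr1 ?mulr0 ?subrr ?subr0.
(* Otherwise [G] would be strictly below its average at every atom, which is impossible for weights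
   of total mass 1. *)
rewrite GE; apply: contrapT => H.
have HG x : x \in ws -> G x.2 < \sum_(x <- ws) x.1 * G x.2.
  move=> /ws2[_ x01]; rewrite ltNge; apply/negP => le; apply: H.
  by exists x.2 => //; exact: le.
have : \sum_(x <- ws) x.1 * (\sum_(x <- ws) x.1 * G x.2 - G x.2) = 0.
  under eq_bigr do rewrite mulrBr.
  by rewrite sumrB -mulr_suml ws1 subr0 mul1r subrr.
move/eqP; rewrite big_seq psumr_eq0; last first.
  by move=> x xws; rewrite mulr_ge0 ?subr_ge0 ?(ltW (HG _ xws))//; case: (ws2 _ xws).
move/allP => H0; suff : \sum_(x <- ws) x.1 = 0 by rewrite ws1 subr0 => /eqP; rewrite oner_eq0.
rewrite big_seq big1// => x xws; have := H0 x xws; rewrite xws/= mulf_eq0.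
by rewrite [_ - _ == 0]gt_eqF ?subr_gt0 ?HG// orbF => /eqP.
Qed.

(** One coordinate is treated at a time, the nonnegative factors of the others being absorbed into
    the weights [a]; each [u i] is common to all [j]. *)
Lemma exists_thresholds (J : finType) (I : eqType) (r : seq I) (p : J -> I -> R)
    (b : J -> I -> bool) (a : J -> R) :
  uniq r -> (forall j i, 0 < p j i < 1) -> (forall j, 0 <= a j) ->
  exists2 u : I -> R, (forall i, 0 < u i < 1) &
    \sum_j a j * \prod_(i <- r) (if b j i then 1 - p j i else p j i) <=
    \sum_j a j * \prod_(i <- r) ((u i <= p j i) == ~~ b j i)%:R.
Proof.
move=> + p01; elim: r a => [|i r IH] a /=.
  move=> _ a0; exists (fun=> 2^-1); first by move=> _; apply/andP; split; lra.
  by apply: ler_sum => j _; rewrite !big_nil.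
move=> /andP[ir ur] a0.
have q0 j k : 0 <= if b j k then 1 - p j k else p j k.
  by have /andP[/ltW p0 /ltW p1] := p01 j k; case: ifP; rewrite ?subr_ge0.
have [u u01 Hu] := IH (fun j => a j * (if b j i then 1 - p j i else p j i)) ur
  (fun j => mulr_ge0 (a0 j) (q0 j i)).
pose a' j := a j * \prod_(i <- r) ((u i <= p j i) == ~~ b j i)%:R.
have a'0 j : 0 <= a' j by rewrite mulr_ge0// prodr_ge0.
have [v v01 Hv] := exists_threshold (b ^~ i) (fun j => p01 j i) a'0.
exists (fun k => if k == i then v else u k); first by move=> k; case: ifP.
under eq_bigr do rewrite big_cons mulrA.
apply: (le_trans Hu); under [leLHS]eq_bigr do rewrite mulrAC.
apply: (le_trans Hv); rewrite le_eqVlt; apply/orP/or_introl/eqP.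
apply: eq_bigr => j _; rewrite big_cons eqxx /a' mulrAC mulrA; congr (_ * _).
apply: eq_big_seq => k kr.
by have /negPf -> : k != i by apply: contraNneq ir => <-.
Qed.

End threshold.

(** * The upper bound, by counting sign patterns *)

(** The matrix of these rows has rank at most [d], hence a nonzero left kernel. Working with indices
    covers repeated vectors. *)
Lemma linear_dependency (R : realType) (I : finType) (d : nat)
    (x : I -> 'rV[R]_d) (A : {set I}) : (d < #|A|)%N ->
  exists lambda : I -> R,
    (forall theta, \sum_(i in A) lambda i * dotp (x i) theta = 0) /\
    exists2 i, i \in A & lambda i != 0.
Proof.
move=> dA; pose M := \matrix_(k < #|A|) x (enum_val k).
have : kermx M != 0.
  by rewrite kermx_eq0 /row_free neq_ltn (leq_ltn_trans (rank_leq_col _)).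
move=> /rowV0Pn[v /sub_kermxP vM v0].
have [i0 i0A] : exists i, i \in A by apply/card_gt0P; exact: leq_ltn_trans dA.
pose lambda i := v 0 (enum_rank_in i0A i).
have lE k : lambda (enum_val k) = v 0 k by rewrite /lambda enum_valK_in.
exists lambda; split => [theta|]; last first.
  have /rV0Pn[k vk] := v0; exists (enum_val k); first exact: enum_valP.
  by rewrite lE.
rewrite big_enum_val/=; under eq_bigr do rewrite lE.
have -> : \sum_k v 0 k * dotp (x (enum_val k)) theta = (v *m M *m theta^T) 0 0.
  rewrite -mulmxA !mxE; apply: eq_bigr => k _; rewrite !mxE; congr (_ * _).
  by apply: eq_bigr => l _; rewrite !mxE.
by rewrite vM mul0mx mxE.
Qed.

Lemma shtarkov_upper (R : realType) (n d : nat) (x : 'I_n -> 'rV[R]_d) :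
  logistic_shtarkov x <= (\sum_(l < d.+1) 'C(n, l))%N%:R.
Proof.
apply: shtarkov_le => theta.
pose p (e : {ffun 'I_n -> bool}) i := sigmoid (dotp (x i) (theta e)).
have p01 e i : 0 < p e i < 1 by rewrite sigmoid_gt0 sigmoid_lt1.
have [u u01 Hu] := exists_thresholds (fun e : {ffun 'I_n -> bool} => e)
  (index_enum_uniq 'I_n) p01 (fun=> ler01).
have -> : \sum_e likelihood x e (theta e) =
    \sum_(e : {ffun 'I_n -> bool}) 1 * \prod_i (if e i then 1 - p e i else p e i).
  apply: eq_bigr => e _; rewrite mul1r.
  by apply: eq_bigr => i _; rewrite sigmoid_sign.
apply: (le_trans Hu).
(* Each summand is now 0 or 1; [F] collects the patterns [e] that [theta e] itself realizes. *)
pose F := [set e : {ffun 'I_n -> bool} | [forall i, (u i <= p e i) == ~~ e i]].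
have -> : \sum_(e : {ffun 'I_n -> bool}) 1 * \prod_i ((u i <= p e i) == ~~ e i)%:R
    = #|F|%:R :> R.
  rewrite -sum1_card natr_sum [RHS]big_mkcond/=; apply: eq_bigr => e _.
  rewrite mul1r inE; case: ifPn => [/forallP H|]; first by rewrite big1// => i _; rewrite H.
  by rewrite negb_forall => /existsP[i /negPf H]; rewrite (bigD1 i)//= H mul0r.
rewrite ler_nat; apply: leq_trans (card_le_shattered F) _.
have -> : (\sum_(l < d.+1) 'C(n, l))%N =
    #|[set A : {set 'I_n} | A \subset [set: 'I_n] & (#|A| < d.+1)%N]|.
  by rewrite card_small_subsets cardsT card_ord.
apply/subset_leq_card/fintype.subsetP => A.
rewrite !inE finset.subsetT/= ltnS => /shattersP HA; rewrite leqNgt; apply/negP => dA.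
(* The logit turns thresholds on probabilities into thresholds on inner products, to which linear
   dependencies apply. *)
pose c i := ln (u i / (1 - u i)).
have cE e i : (u i <= p e i) = (c i <= dotp (x i) (theta e)).
  by rewrite -(le_sigmoid (c i)) /c sigmoid_logit//; case/andP: (u01 i).
have [lambda [Hlambda [i0 i0A l0]]] := linear_dependency x dA.
(* The dependency forces sum lambda_i (<x_i, theta> - c_i) to be independent of
   theta, whereas prescribing the signs of <x_i, theta> - c_i lets one choose
   its sign, strictly on one side. *)
have key s : 0 <= \sum_(i in A) s * lambda i * c i /\
    (0 < s * lambda i0 -> 0 < \sum_(i in A) s * lambda i * c i).
  have [g gF gs] := HA (fun i => 0 < s * lambda i).
  have gc i : i \in A -> s * lambda i * dotp (x i) (theta g) <= s * lambda i * c i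
      /\ (0 < s * lambda i -> s * lambda i * dotp (x i) (theta g) < s * lambda i * c i).
    move=> iA; have := gF; rewrite inE => /forallP /(_ i).
    rewrite gs// cE; case: ltrgtP => [sp|sn|<-] /eqP.
    - by rewrite !ltr_pM2l// ler_pM2l// => /negbT; rewrite -ltNge => H; rewrite (ltW H).
    - by rewrite ler_nM2l// => ->.
    - by rewrite !mul0r.
  have t0 : 0 = \sum_(i in A) s * lambda i * dotp (x i) (theta g).
    by under eq_bigr do rewrite -mulrA; rewrite -mulr_sumr Hlambda mulr0.
  split=> [|l0']; first by rewrite {1}t0; apply: ler_sum => i /gc[].
  rewrite {1}t0 (bigD1 i0)//= [ltRHS](bigD1 i0)//=.
  by apply: ltr_leD; [case: (gc _ i0A) => _; apply|apply: ler_sum => i /andP[/gc[]]].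
(* The sign of [lambda i0] makes the sum positive, while the opposite sign makes its negation
   nonnegative. *)
have [_ Hi0] := key (Num.sg (lambda i0)).
have [H _] := key (- Num.sg (lambda i0)).
move: Hi0; rewrite -normrEsg normr_gt0 => /(_ l0).
rewrite ltNge -oppr_ge0 -sumrN.
by under eq_bigr do rewrite -!mulNr; rewrite H.
Qed.

(** * Sign patterns under general position *)

(** For small [delta] the finitely many conditions [delta * |b i| < |a i|] hold together, and then
    the sign of [a i] survives. *)
Lemma small_perturbation (R : realType) (I : finType) (a b : I -> R) :
  exists2 delta, 0 < delta & forall i, a i != 0 -> 0 < a i * (a i + delta * b i).
Proof.
have [delta d0 Hd] : exists2 delta, 0 < delta &
    forall i, i \in enum I -> a i != 0 -> delta * `|b i| < `|a i|.
  elim: (enum I) => [|i s [delta d0 IH]]; first by exists 1.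
  have [ai|ai] := eqVneq (a i) 0.
    by exists delta => // j; rewrite inE => /orP[/eqP ->|/IH//]; rewrite ai eqxx.
  (* The [1 +] avoids a division by 0 when [b i = 0]. *)
  pose e := `|a i| / (1 + `|b i|).
  have b1 : 0 < 1 + `|b i| by rewrite ltr_wpDr.
  have e0 : 0 < e by rewrite divr_gt0 ?normr_gt0.
  exists (Num.min delta e); first by rewrite lt_min d0.
  move=> j; rewrite inE => /orP[/eqP -> _|js aj].
    apply: (@le_lt_trans _ _ (e * `|b i|)); first by rewrite ler_wpM2r// ge_min lexx orbT.
    by rewrite /e mulrAC ltr_pdivrMr// ltr_pM2l ?normr_gt0// ltrDr.
  by apply: le_lt_trans (IH j js aj); rewrite ler_wpM2r// ge_min lexx.
exists delta => // i ai; have := Hd i (mem_enum _ _) ai.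
rewrite -{1}[delta]gtr0_norm// -normrM; move: (delta * b i) => y.
case: (ltrgtP (a i) 0) ai => // a0 _.
  by rewrite (ltr0_norm a0) ltr_norml => /andP[_ ?]; rewrite nmulr_rgt0//; lra.
by rewrite (gtr0_norm a0) ltr_norml => /andP[? _]; rewrite pmulr_rgt0//; lra.
Qed.

Section general_position.
Context {R : realType} {n d : nat} (x : 'I_n -> 'rV[R]_d).
Context (gp : general_position x).

Lemma general_position_dual (A : {set 'I_n}) (tau : 'I_n -> R) : (#|A| <= d)%N ->
  exists v, {in A, forall i, dotp (x i) v = tau i}.
Proof. by move=> /gp /(dual_family tau)[v Hv]; exists v. Qed.

(** Indices outside [S] are treated one at a time: if [v] vanishes at [i], a multiple of a vector
    orthogonal to [S] and dual to [i] is added, too small to undo earlier progress. *)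
Lemma general_position_generic (S : {set 'I_n}) : (#|S| < d)%N ->
  exists v, forall i, (dotp (x i) v == 0) = (i \in S).
Proof.
move=> Sd.
suff H (T : {set 'I_n}) : [disjoint S & T] -> exists v,
    {in S, forall i, dotp (x i) v = 0} /\ {in T, forall i, dotp (x i) v != 0}.
  have [|v [v0 v1]] := H (~: S); first by rewrite finset.disjoints_subset finset.setCK.
  exists v => i; have [iS|iS] := boolP (i \in S); first by rewrite v0// eqxx.
  by apply/negbTE/v1; rewrite inE.
elim: {T}_.+1 {-2}T (ltnSn #|T|) => // m IH T; rewrite ltnS => Tm ST.
have [->|[i iT]] := set_0Vmem T.
  by exists 0; split => i; rewrite ?inE// dotp0r.
have iS : i \notin S by move/disjointFl : ST => /(_ _ iT) ->.
have [||v [v0 v1]] := IH (T :\ i).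
- by apply: leq_trans Tm; rewrite [ltnRHS](cardsD1 i) iT.
- by apply: disjointWr ST; rewrite subD1set.
(* The strict bound on [#|S|] keeps [i |: S] within [d] indices. *)
have [|w wE] := @general_position_dual (i |: S) (fun j => (j == i)%:R).
  by rewrite cardsU1 iS.
have [vi|vi] := eqVneq (dotp (x i) v) 0; last first.
  exists v; split => // j jT; have [->//|ji] := eqVneq j i.
  by apply: v1; rewrite !inE ji.
have [delta delta0 Hd] :=
  small_perturbation (fun j => dotp (x j) v) (fun j => dotp (x j) w).
exists (v + delta *: w); split => j jX; rewrite dotpDr dotpZr.
  rewrite v0// wE ?inE ?jX ?orbT// add0r.
  by have /negPf -> : j != i; rewrite ?mulr0//; apply: contraNneq iS => <-.
have [->|ji] := eqVneq j i.
  by rewrite vi wE ?inE ?eqxx// mulr1 add0r gt_eqF.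
have := Hd j (v1 j _); rewrite !inE ji jX => /(_ isT).
by apply: contraTneq => ->; rewrite mulr0 ltxx.
Qed.

Definition realizable (e : {ffun 'I_n -> bool}) :=
  exists theta, forall i, 0 < (-1) ^+ e i * dotp (x i) theta.

Lemma shtarkov_ge_realizable :
  #|[set e | `[< realizable e >]]|%:R <= logistic_shtarkov x.
Proof.
rewrite -sum1_card natr_sum big_mkcond/=; apply: ler_sum => e _.
rewrite inE; case: asboolP => [[theta]|_]; first exact: sup_likelihood_ge1.
by apply: le_trans (likelihood_le_sup x e 0); rewrite ltW ?likelihood_gt0.
Qed.

(* A generic vector orthogonal to x_i for i in S alone can be perturbed so as to
   realize every sign pattern on S, hence S is strongly shattered. *)
Lemma card_realizable (i0 : 'I_n) :
  ((\sum_(l < d) 'C(n - 1, l)) * 2 <= #|[set e | `[< realizable e >]]|)%N.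
Proof.
set F := [set e | _].
have FP e : reflect (realizable e) (e \in F).
  by rewrite finset.in_set; exact: asboolP.
pose G := [set e in F | ~~ e i0].
pose neg (e : {ffun 'I_n -> bool}) := [ffun i => ~~ e i].
have negK : involutive neg by move=> e; apply/ffunP => i; rewrite !ffunE negbK.
have negF e : e \in F -> neg e \in F.
  move=> /FP[theta H]; apply/FP; exists ((-1) *: theta) => i.
  by rewrite ffunE dotpZr mulrA signrN mulrN1 opprK.
have FG : (#|G| * 2 <= #|F|)%N.
  rewrite muln2 -addnn -{2}(card_imset _ (can_inj negK)).
  rewrite -cardsUI [X in (_ + #|pred_of_set X|)%N](_ : _ = finset.set0); last first.
    apply/setP => e; rewrite finset.in_set0; apply/negP => /finset.setIP[].
    by rewrite inE => /andP[_ ei] /imsetP[f]; rewrite inE => /andP[_ fi] ef;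
      move: ei; rewrite ef ffunE fi.
  rewrite cards0 addn0; apply/subset_leq_card/fintype.subsetP => e.
  rewrite finset.in_setU => /orP[|/imsetP[f fG ->]]; first by rewrite inE => /andP[].
  by apply: negF; move: fG; rewrite inE => /andP[].
apply: leq_trans FG; rewrite leq_mul2r/=.
have -> : (n - 1)%N = #|~: [set i0]| by rewrite cardsC1 card_ord subn1.
rewrite -card_small_subsets; apply: card_ge_strongly_shattered => S.
rewrite inE => /andP[Si0 Sd].
have i0S : i0 \notin S by apply/negP => /(fintype.subsetP Si0); rewrite !inE eqxx.
have [v0 v0E] := general_position_generic Sd.
have [v vE vi0] : exists2 v, (forall i, (dotp (x i) v == 0) = (i \in S)) &
    0 < dotp (x i0) v.
  exists (Num.sg (dotp (x i0) v0) *: v0) => [i|]; rewrite dotpZr.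
    by rewrite mulf_eq0 sgr_eq0 !v0E (negPf i0S).
  by rewrite -normrEsg normr_gt0 v0E.
exists (fun i => dotp (x i) v < 0) => g gE.
have gi0 : ~~ g i0 by rewrite gE ?inE// -leNgt ltW.
rewrite inE ffunE gi0 andbT; apply/FP.
have [w wE] := general_position_dual (fun i => (-1) ^+ g i) (ltnW Sd).
have [delta delta0 Hd] :=
  small_perturbation (fun j => dotp (x j) v) (fun j => dotp (x j) w).
exists (v + delta *: w) => i; rewrite ffunE dotpDr dotpZr.
have [iS|iS] := boolP (i \in S).
  move: (iS); rewrite -vE => /eqP ->.
  by rewrite wE// add0r mulrCA -expr2 sqrr_sign mulr1.
have vi : dotp (x i) v != 0 by rewrite vE.
have := Hd i vi; rewrite gE ?inE//.
case: (ltrgtP (dotp (x i) v) 0) vi => // vi _.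
  by rewrite nmulr_rgt0// expr1 mulN1r oppr_gt0.
by rewrite pmulr_rgt0// expr0 mul1r.
Qed.

End general_position.

(** * Newton's inequalities *)

Section newton.
Context {R : realType}.

(** The generating polynomial of a sum of independent Bernoulli variables with parameters in [s]. *)
Definition bernoulli_sum_poly (s : seq R) : {poly R} :=
  \prod_(q <- s) ((1 - q)%:P + q *: 'X).

(** [a], [b], [c], [d] are consecutive normalized coefficients before multiplication by
    [(1 - q) + q X]. Bounding [b * d], [a * c] and [a * d] by the hypotheses leaves exactly
    [((1 - q) * c - q * b) ^+ 2]. *)
Lemma newton_step (m j q a b c d : R) :
  1 <= j -> 1 <= m -> 0 <= q <= 1 -> 0 <= a -> 0 <= b -> 0 <= c -> 0 <= d ->
  a * c <= b ^+ 2 -> b * d <= c ^+ 2 -> a * d <= b * c ->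
  ((m + 1) * (1 - q) * b + (j - 1) * q * a) *
    ((m - 1) * (1 - q) * d + (j + 1) * q * c)
  <= (m * (1 - q) * c + j * q * b) ^+ 2.
Proof.
move=> j1 m1 /andP[q0 q1] a0 b0 c0 d0 ac bd ad.
have p0 : 0 <= 1 - q by rewrite subr_ge0.
move: (1 - q) p0 => p p0.
have h1 : (m ^+ 2 - 1) * (b * d) <= (m ^+ 2 - 1) * c ^+ 2.
  by rewrite ler_wpM2l// subr_ge0 expr_ge1// (le_trans ler01).
have h2 : (j ^+ 2 - 1) * (a * c) <= (j ^+ 2 - 1) * b ^+ 2.
  by rewrite ler_wpM2l// subr_ge0 expr_ge1// (le_trans ler01).
have h3 : (j - 1) * (m - 1) * (a * d) <= (j - 1) * (m - 1) * (b * c).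
  by rewrite ler_wpM2l// mulr_ge0// subr_ge0.
have := ler_wpM2l (exprn_ge0 2 p0) h1.
have := ler_wpM2l (exprn_ge0 2 q0) h2.
have := ler_wpM2l (mulr_ge0 p0 q0) h3.
have := sqr_ge0 (p * c - q * b).
nra.
Qed.

(** Two consecutive inequalities are multiplied and the positive factor [c j.+1 * c j.+2] is
    cancelled. *)
Lemma log_concave_gap (c : nat -> R) n :
  (forall j, (j <= n)%N -> 0 < c j) -> (forall j, (n < j)%N -> c j = 0) ->
  (forall j, c j * c j.+2 <= c j.+1 ^+ 2) ->
  forall j, c j * c j.+3 <= c j.+1 * c j.+2.
Proof.
move=> cp c0 c2 j.
have cge0 i : 0 <= c i by have [/cp/ltW|/c0 ->] := leqP i n.
have [jn|jn] := leqP j.+3 n; last by rewrite (c0 j.+3)// mulr0 mulr_ge0.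
have b0 : 0 < c j.+1 * c j.+2 by rewrite mulr_gt0// cp//; lia.
rewrite -(ler_pM2r b0) -[leRHS]expr2 exprMn.
have -> : c j * c j.+3 * (c j.+1 * c j.+2) = c j * c j.+2 * (c j.+1 * c j.+3) by ring.
by rewrite ler_pM ?mulr_ge0.
Qed.

Lemma newton_inequalities (s : seq R) : {in s, forall q, 0 < q < 1} ->
  exists c : nat -> R,
    [/\ forall j, (j <= size s)%N -> 0 < c j,
        forall j, (size s < j)%N -> c j = 0,
        forall j, (bernoulli_sum_poly s)`_j = 'C(size s, j)%:R * c j &
        forall j, c j * c j.+2 <= c j.+1 ^+ 2].
Proof.
elim: s => [|q s IH] Hs.
  exists (fun j => (j == 0%N)%:R); split=> //.
  - by case.
  - by case.
  - by move=> j; rewrite /bernoulli_sum_poly big_nil coef1; case: j => [|j];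
      rewrite ?bin0 ?mul1r// mulr0.
  - by move=> j; rewrite mulr0 sqr_ge0.
have [|c [cp c0 cE c2]] := IH; first by move=> x xs; apply: Hs; rewrite inE xs orbT.
have /andP[q0 q1] : 0 < q < 1 by apply: Hs; rewrite inE eqxx.
have p0 : 0 < 1 - q by rewrite subr_gt0.
set n := size s in cp c0 cE *.
have c3 := log_concave_gap cp c0 c2.
have cge0 j : 0 <= c j by have [/cp/ltW|/c0 ->] := leqP j n.
(* [n.+1] times the new normalized coefficient, by [(n + 1 - j) C(n + 1, j) = (n + 1) C(n, j)] and
   [j C(n + 1, j) = (n + 1) C(n, j - 1)]. At [j = 0] the meaningless [c j.-1] has factor 0. *)
pose e j := (n.+1%:R - j%:R) * (1 - q) * c j + j%:R * q * c j.-1.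
have eE j : e j = (n.+1 - j)%:R * (1 - q) * c j + j%:R * q * c j.-1.
  rewrite /e; have [jn|jn] := leqP j n.+1; first by rewrite natrB.
  by rewrite c0 ?mulr0// (ltn_trans _ jn).
have ege0 j : 0 <= e j by rewrite eE addr_ge0// !mulr_ge0// ltW.
have e2 j : e j * e j.+2 <= e j.+1 ^+ 2.
  have [jn|jn] := ltnP j n; last first.
    by rewrite [e j.+2]eE c0 ?mulr0 ?add0r ?c0 ?mulr0 ?sqr_ge0//; lia.
  (* 0 stands for the coefficient before the first one. *)
  pose a := if j is i.+1 then c i else 0.
  have jR : 1 <= j.+1%:R :> R by rewrite ler1n.
  have mR : 1 <= n.+1%:R - j.+1%:R :> R by rewrite -natrB ?ler1n; lia.
  have := @newton_step (n.+1%:R - j.+1%:R) j.+1%:R q a (c j) (c j.+1) (c j.+2) jR mR.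
  have q01 : 0 <= q <= 1 by rewrite !ltW.
  move=> /(_ q01) H.
  have -> : e j = (n.+1%:R - j.+1%:R + 1) * (1 - q) * c j + (j.+1%:R - 1) * q * a.
    rewrite /e /a; case: (j) => [|i]; rewrite -[in RHS]natr1; ring.
  have -> : e j.+2 = (n.+1%:R - j.+1%:R - 1) * (1 - q) * c j.+2 +
      (j.+1%:R + 1) * q * c j.+1.
    by rewrite /e /= -[j.+2%:R]natr1; ring.
  apply: H => //; rewrite /a; case: (j) => [|i]//; rewrite ?mul0r ?mulr_ge0 ?sqr_ge0//.
exists (fun j => e j / n.+1%:R); split=> [j jn|j jn|j|j].
- rewrite divr_gt0// eE; have [->|j0] := posnP j.
    by rewrite mul0r mul0r addr0 !mulr_gt0 ?cp ?ltr0n.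
  rewrite ltr_wpDl//; first by rewrite !mulr_ge0// ltW.
  by rewrite !mulr_gt0 ?ltr0n// cp//; rewrite /= in jn; lia.
- by rewrite eE !c0 ?mulr0 ?addr0 ?mul0r//; rewrite /= in jn; lia.
- rewrite /bernoulli_sum_poly big_cons -/(bernoulli_sum_poly s) mulrDl coefD.
  rewrite coefCM -scalerAl coefZ coefXM !cE/= -/n [RHS]mulrA.
  apply: (canRL (mulfK _)); first by rewrite pnatr_eq0.
  rewrite eE mulrDr !mulrA -!natrM.
  have -> : ('C(n.+1, j) * (n.+1 - j) = n.+1 * 'C(n, j))%N.
    by rewrite mulnC -mul_bin_down.
  case: j => [|j] /=; first by rewrite !natrM; ring.
  have -> : ('C(n.+1, j.+1) * j.+1 = n.+1 * 'C(n, j))%N.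
    by rewrite mulnC -mul_bin_diag.
  by rewrite !natrM; ring.
- rewrite expr2 mulrACA -[leRHS]mulrACA ler_wpM2r ?mulr_ge0 ?invr_ge0//.
Qed.

End newton.

(** * The mass that a sum of Bernoulli variables puts on its integer mean *)

Section mean_mass.
Context {R : realType}.

(** Ratios of consecutive terms are nonincreasing, so the geometric sequence through the terms [k]
    and [k.+1] dominates. Powers of [rho] on both sides avoid negative exponents. *)
Lemma log_concave_tangent (c : nat -> R) n k :
  (forall j, (j <= n)%N -> 0 < c j) ->
  (forall j, c j * c j.+2 <= c j.+1 ^+ 2) -> (k < n)%N ->
  let rho := c k.+1 / c k in
  forall j, (j <= n)%N -> c j * rho ^+ k <= c k * rho ^+ j.
Proof.
move=> cp c2 kn rho.
have rho0 : 0 < rho by rewrite divr_gt0 ?cp// ltnW.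
have ratio j i : (j + i < n)%N -> c (j + i).+1 * c j <= c (j + i)%N * c j.+1.
  elim: i => [|i IH]; first by rewrite addn0 mulrC.
  rewrite addnS => ji; have p1 : 0 < c (j + i)%N by rewrite cp//; lia.
  have p2 : 0 < c (j + i).+1 by rewrite cp//; lia.
  have p3 : 0 < c j by rewrite cp//; lia.
  have IH' := IH (ltnW ji); have h := c2 (j + i)%N.
  rewrite -(ler_pM2l p1) mulrA; apply: le_trans (ler_wpM2r (ltW p3) h) _.
  by rewrite expr2 -mulrA [leRHS]mulrCA ler_pM2l.
have up i : (k + i <= n)%N -> c (k + i)%N <= c k * rho ^+ i.
  elim: i => [|i IH]; first by rewrite addn0 mulr1.
  rewrite addnS => ki; have := ratio k i ki.
  rewrite -ler_pdivlMr ?cp//; last by lia.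
  move=> /le_trans; apply; rewrite -mulrA exprSr [leRHS]mulrA ler_pM2r// IH//; lia.
have down i : (i <= k)%N -> c (k - i)%N * rho ^+ i <= c k.
  elim: i => [|i IH] ik; first by rewrite subn0 mulr1.
  apply: le_trans (IH (ltnW ik)); rewrite exprS mulrA ler_pM2r ?exprn_gt0//.
  have := ratio (k - i.+1)%N i.+1; rewrite subnK// => /(_ kn).
  have -> : (k - i.+1).+1 = (k - i)%N by lia.
  rewrite mulrA ler_pdivrMr ?cp//; last by lia.
  by rewrite mulrC [leRHS]mulrC.
move=> j jn; have [jk|/ltnW kj] := leqP j k.
  have := down (k - j)%N (leq_subr _ _); rewrite subKn// => H.
  rewrite -{1}(subnK jk) exprD mulrA ler_pM2r ?exprn_gt0//.
have := up (j - k)%N; rewrite subnKC// => /(_ jn) H.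
by rewrite -[in leRHS](subnK kj) exprD mulrA ler_pM2r ?exprn_gt0.
Qed.

(** Weighted AM-GM: [1 + t <= exp t] is used at [- ln A] and [ln z - ln A], where the right sides
    average to 1. *)
Lemma powR_le_affine (q z : R) : 0 <= q <= 1 -> 0 < z ->
  expR (q * ln z) <= 1 - q + q * z.
Proof.
move=> /andP[q0 q1] z0.
have [->|qn0] := eqVneq q 0; first by rewrite !mul0r expR0 subr0 addr0.
set A := 1 - q + q * z.
have A0 : 0 < A by rewrite ltr_wpDl ?subr_ge0// mulr_gt0// lt_def qn0.
have h1 := expR_ge1Dx (- ln A + ln z); have h2 := expR_ge1Dx (- ln A).
rewrite expRD expRN !lnK// in h1 h2.
rewrite -[leRHS]lnK// ler_expR -subr_ge0.
have h : (1 - q) * (1 - ln A) + q * (1 - ln A + ln z) <= 1.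
  have E : (1 - q) * A^-1 + q * (A^-1 * z) = 1.
    by rewrite mulrCA mulrC -mulrDr mulVf ?gt_eqF.
  by rewrite -[leRHS]E; apply: lerD; apply: ler_wpM2l; rewrite ?subr_ge0 -?addrA.
lra.
Qed.

(* With r(z) = sum_j r_j z^j the generating polynomial and r_j = C(n,j) c_j,
   log-concavity of c gives r(z) <= c_k rho^-k (1 + rho z)^n, while Jensen gives
   r(z) >= z^k since the mean is k; compare at z = k / (rho (n - k)). *)
Lemma mass_at_mean (s : seq R) (k l : nat) :
  {in s, forall q, 0 < q < 1} -> (0 < k)%N -> (0 < l)%N ->
  size s = (k + l)%N -> \sum_(q <- s) q = k%:R ->
  'C(k + l, k)%:R * (k%:R ^+ k * l%:R ^+ l / (k + l)%:R ^+ (k + l))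
    <= (bernoulli_sum_poly s)`_k.
Proof.
move=> s01 k0 l0 sz mean; set n := (k + l)%N.
have kn : (k < n)%N by rewrite /n -[ltnLHS]addn0 ltn_add2l.
have [c [cp c0 cE c2]] := newton_inequalities s01.
rewrite sz -/n in cp c0 cE *.
have ckp := cp _ (ltnW kn); have ck1p := cp _ kn.
pose rho := c k.+1 / c k; have rho0 : 0 < rho by rewrite divr_gt0.
have kR : 0 < k%:R :> R by rewrite ltr0n.
have lR : 0 < l%:R :> R by rewrite ltr0n.
have nR : 0 < n%:R :> R by rewrite ltr0n (ltn_trans k0).
(* The minimizer of [(1 + rho z)^n / z^k], where [rho z = k / l] and [1 + rho z = n / l]. *)
pose z := k%:R / (rho * l%:R); have z0 : 0 < z := divr_gt0 kR (mulr_gt0 rho0 lR).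
have szp : (size (bernoulli_sum_poly s) <= n.+1)%N.
  by apply/leq_sizeP => j jn; rewrite cE c0 ?mulr0.
have lower : z ^+ k <= (bernoulli_sum_poly s).[z].
  rewrite /bernoulli_sum_poly horner_prod.
  have -> : z ^+ k = \prod_(q <- s) expR (q * ln z).
    by rewrite -expR_sum -mulr_suml mean expRM_natl lnK.
  rewrite big_seq [leRHS]big_seq; apply: ler_prod => q qs.
  rewrite expR_ge0 hornerD hornerC hornerZ hornerX powR_le_affine//.
  by have /andP[/ltW -> /ltW ->] := s01 q qs.
have upper : (bernoulli_sum_poly s).[z] * rho ^+ k <= c k * (1 + rho * z) ^+ n.
  rewrite (horner_coef_wide _ szp) mulr_suml exprDn mulr_sumr.
  apply: ler_sum => j _; rewrite cE expr1n mul1r.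
  have := log_concave_tangent cp c2 kn (ltn_ord j : (j <= n)%N).
  rewrite -/rho => h.
  have w0 : 0 <= 'C(n, j)%:R * z ^+ j by rewrite mulr_ge0// exprn_ge0// ltW.
  have -> : c k * ((rho * z) ^+ j *+ 'C(n, j)) =
      'C(n, j)%:R * z ^+ j * (c k * rho ^+ j).
    rewrite [(rho * z) ^+ j]exprMn mulrnAr -[RHS]mulrA [RHS]mulr_natl.
    by congr (_ *+ _); rewrite mulrA [RHS]mulrC.
  by rewrite [leLHS](_ : _ = 'C(n, j)%:R * z ^+ j * (c j * rho ^+ k)) ?ler_wpM2l//; ring.
rewrite cE ler_wpM2l//.
have {upper}H := le_trans (ler_wpM2r (exprn_ge0 k (ltW rho0)) lower) upper.
have rz : z * rho = k%:R / l%:R by rewrite /z; field; rewrite !gt_eqF.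
have rz1 : 1 + rho * z = n%:R / l%:R.
  by rewrite mulrC rz /n natrD; field; rewrite gt_eqF.
rewrite -exprMn rz rz1 !expr_div_n in H.
rewrite ler_pdivrMr ?exprn_gt0// -(@ler_pM2r _ (l%:R ^- n)) ?invr_gt0 ?exprn_gt0//.
rewrite -[leRHS]mulrA; apply: le_trans H.
by rewrite /n exprD; rewrite le_eqVlt; apply/orP/or_introl/eqP; field; rewrite !expf_neq0 ?gt_eqF.
Qed.

End mean_mass.

(** * Central binomial weights and a lower bound for binomial masses *)

Section central_binomial.
Context {R : realType}.

(* wallis k is 'C(2k, k) / 4^k. *)
Fixpoint wallis (k : nat) : R :=
  if k is k'.+1 then wallis k' * (k'.*2.+1%:R / k'.*2.+2%:R) else 1.

Lemma wallis_gt0 k : 0 < wallis k.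
Proof. by elim: k => [|k IH] //=; rewrite mulr_gt0// divr_gt0. Qed.

Lemma wallisS k : k.+1%:R * wallis k.+1 = (k%:R + 2^-1) * wallis k.
Proof.
have E1 : k.*2.+1%:R = 2 * k%:R + 1 :> R by rewrite -natr1 -muln2 natrM mulrC.
have E2 : k.*2.+2%:R = 2 * (k%:R + 1) :> R by rewrite -natr1 E1; ring.
rewrite /= E1 E2 -natr1; field.
by rewrite natr1 pnatr_eq0.
Qed.

(** The left side is nonincreasing in [k], because [(2k + 1) (2k + 3) <= (2k + 2)^2], and starts at
    1. *)
Lemma wallis_sqr k : wallis k ^+ 2 * k.*2.+1%:R <= 1.
Proof.
elim: k => [|k IH]; first by rewrite expr1n mul1r.
apply: le_trans IH; rewrite /= exprMn -mulrA ler_wpM2l ?sqr_ge0//.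
have k0 : 0 <= k%:R :> R by [].
have E1 : k.*2.+1%:R = 2 * k%:R + 1 :> R by rewrite -natr1 -muln2 natrM mulrC.
have E2 : k.*2.+2%:R = 2 * k%:R + 2 :> R by rewrite -natr1 E1; ring.
have E3 : k.*2.+3%:R = 2 * k%:R + 3 :> R by rewrite -natr1 E2; ring.
rewrite doubleS E1 E2 E3 expr_div_n mulrAC ler_pdivrMr ?exprn_gt0; nra.
Qed.

Lemma wallis_fact k : wallis k * (4 ^+ k * k`!%:R ^+ 2) = (k.*2)`!%:R.
Proof.
elim: k => [|k IH]; first by rewrite fact0 expr1n !mulr1.
rewrite doubleS !factS !natrM -IH /= exprS.
have -> : k.*2.+2%:R = 2 * k.+1%:R :> R by rewrite -natrM mul2n.
by field; rewrite nat1r pnatr_eq0.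
Qed.

(* The sequence of coefficients of (1 - X)^(-1/2), whose square is the
   geometric series. *)
Lemma wallis_conv n : \sum_(k < n.+1) wallis k * wallis (n - k) = 1.
Proof.
elim: n => [|n IH]; first by rewrite big_ord1 mulr1.
have sym m (f : nat -> R) : \sum_(k < m.+1) f k = \sum_(k < m.+1) f (m - k)%N.
  by rewrite (reindex_inj rev_ord_inj); apply: eq_bigr => k _; rewrite /= subSS.
(* Symmetry under [k -> m - k] replaces the weight [k] by [m / 2], so that [wallisS] yields a
   recurrence for the convolution. *)
have half m : \sum_(k < m.+1) k%:R * (wallis k * wallis (m - k)) =
    m%:R / 2 * \sum_(k < m.+1) wallis k * wallis (m - k).
  set A := LHS.
  have : A + A = m%:R * \sum_(k < m.+1) wallis k * wallis (m - k).
    rewrite {2}/A (sym m (fun k => k%:R * (wallis k * wallis (m - k)))) -big_split mulr_sumr.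
    apply: eq_bigr => k _; have km : (k <= m)%N by rewrite -ltnS.
    by rewrite /= subKn// natrB//; ring.
  by move=> H; rewrite mulrAC -H; field.
have : \sum_(k < n.+1) k.+1%:R * (wallis k.+1 * wallis (n - k)) =
    n.+1%:R / 2 * \sum_(k < n.+2) wallis k * wallis (n.+1 - k).
  rewrite -half [RHS]big_ord_recl mul0r add0r.
  by apply: eq_bigr => k _; rewrite lift0 subSS.
under eq_bigr do rewrite mulrA wallisS -mulrA mulrDl.
rewrite big_split/= half -mulr_sumr IH => H.
apply: (mulfI (_ : n.+1%:R / 2 != 0)); first by rewrite mulf_neq0.
by rewrite -H -natr1; field.
Qed.

(** The binomial expansion cut at odd order; the induction step leaves the nonnegative remainder
    [k (k - 1) (k - 2) / 6 * x^4]. *)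
Lemma bernoulli3 (x : R) k : 0 <= x <= 1 ->
  1 - k%:R * x + k%:R * (k%:R - 1) / 2 * x ^+ 2
    - k%:R * (k%:R - 1) * (k%:R - 2) / 6 * x ^+ 3 <= (1 - x) ^+ k.
Proof.
move=> /andP[x0 x1]; elim: k => [|k IH]; first by rewrite expr0; lra.
have k3 : 0 <= k%:R * (k%:R - 1) * (k%:R - 2) :> R.
  case: k {IH} => [|[|k]]; first by rewrite !mul0r.
    by rewrite subrr mulr0 mul0r.
  by apply: mulr_ge0; rewrite ?mulr_ge0// subr_ge0 ler_nat.
rewrite [leRHS]exprS; apply: le_trans (ler_wpM2l _ IH); last by rewrite subr_ge0.
rewrite -subr_ge0 -natr1; set a := k%:R in k3 *.
rewrite [X in 0 <= X](_ : _ = a * (a - 1) * (a - 2) / 6 * x ^+ 4); last by field.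
by rewrite mulr_ge0 ?exprn_ge0// divr_ge0.
Qed.

(* The ratio of k^k / k! to wallis k. It is log-convex (stirling_step_mono), so a
   product over k + l = n is least when k and l are as close as possible, where it
   reduces to wallis_sqr. *)
Definition stirling_ratio (k : nat) : R := k%:R ^+ k / (k`!%:R * wallis k).

Lemma stirling_ratio_gt0 k : 0 < stirling_ratio k.
Proof.
rewrite /stirling_ratio divr_gt0 ?mulr_gt0 ?wallis_gt0 ?ltr0n ?fact_gt0//.
by case: k => [|k]; rewrite ?expr0// exprn_gt0.
Qed.

Definition stirling_step (k : nat) : R :=
  2 * k.+1%:R ^+ k.+1 / (k%:R ^+ k * k.*2.+1%:R).

Lemma stirling_ratioS k :
  stirling_ratio k.+1 = stirling_step k * stirling_ratio k.
Proof.
have E : wallis k.+1 * k.+1%:R * 2 = wallis k * k.*2.+1%:R.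
  have -> : k.*2.+1%:R = 2 * k%:R + 1 :> R by rewrite -natr1 -muln2 natrM mulrC.
  by rewrite [wallis k.+1 * _]mulrC wallisS; field.
have w0 := wallis_gt0 k; have w1 := wallis_gt0 k.+1.
have f0 : k`!%:R != 0 :> R by rewrite pnatr_eq0 -lt0n fact_gt0.
have kk : k%:R ^+ k != 0 :> R by case: (k) => [|j]; rewrite ?expr0 ?oner_eq0// expf_neq0.
rewrite /stirling_ratio /stirling_step factS natrM.
rewrite [k.+1%:R * k`!%:R * _](_ : _ = k`!%:R * (wallis k * k.*2.+1%:R) / 2); last first.
  by rewrite -E; field.
field.
by rewrite kk f0 gt_eqF//= nat1r pnatr_eq0.
Qed.

(* After clearing denominators, a third-order expansion of (1 - (k+1)^-2)^k leaves
   a polynomial with positive coefficients; lower orders do not suffice. *)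
Lemma stirling_step_mono k : stirling_step k <= stirling_step k.+1.
Proof.
pose y : R := k%:R; have y0 : 0 <= y by [].
have E0 : k.*2.+1%:R = 2 * y + 1 :> R by rewrite -natr1 -muln2 natrM mulrC.
have E1 : k.+1.*2.+1%:R = 2 * y + 3 :> R by rewrite (_ : k.+1.*2.+1 = k.*2.+1 + 2)%N; [rewrite natrD E0; ring|lia].
have E2 : k.+1%:R = y + 1 :> R by rewrite -natr1.
have E3 : k.+2%:R = y + 2 :> R by rewrite -natr1 E2; ring.
(* The quotient of consecutive steps contains [(k (k + 2) / (k + 1)^2)^k], which is
   [(1 - M^-1)^k]. *)
pose M := (y + 1) ^+ 2.
have M0 : 0 < M by rewrite exprn_gt0// ltr_wpDl.
have M1 : 1 <= M by rewrite expr_ge1// ?addr_ge0// lerDr.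
have H := @bernoulli3 M^-1 k; rewrite -/y in H.
have {}H := H (_ : 0 <= M^-1 <= 1).
have {H} : 1 - y * M^-1 + y * (y - 1) / 2 * M^-1 ^+ 2
    - y * (y - 1) * (y - 2) / 6 * M^-1 ^+ 3 <= (1 - M^-1) ^+ k.
  by apply: H; rewrite invr_ge0 ltW//= invf_le1.
have -> : 1 - M^-1 = y * (y + 2) / M.
  by rewrite /M; field; rewrite gt_eqF// ltr_wpDl.
set P := (X in X <= _) => HP.
have key : M * (2 * y + 3) <= P * ((y + 2) ^+ 2 * (2 * y + 1)).
  have -> : P = (6 * M ^+ 3 - 6 * y * M ^+ 2 + 3 * y * (y - 1) * M
      - y * (y - 1) * (y - 2)) / (6 * M ^+ 3).
    by rewrite /P; field; rewrite gt_eqF.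
  have M3 : 0 < 6 * M ^+ 3 by rewrite mulr_gt0// exprn_gt0.
  rewrite [leRHS]mulrAC ler_pdivlMr// -subr_ge0.
  have : exists p, 0 <= p /\ p = (6 * M ^+ 3 - 6 * y * M ^+ 2 + 3 * y * (y - 1) * M -
    y * (y - 1) * (y - 2)) * ((y + 2) ^+ 2 * (2 * y + 1)) -
    M * (2 * y + 3) * (6 * M ^+ 3).
    exists (y ^+ 6 + 6 * y ^+ 5 + 20 * y ^+ 4 + 29 * y ^+ 3 + 18 * y ^+ 2 + 16 * y + 6).
    by split; [rewrite !addr_ge0 ?mulr_ge0 ?exprn_ge0|rewrite /M; ring].
  by case=> p [p0 <-].
have kk : 0 < y ^+ k by rewrite /y; case: (k) => [|j]; rewrite ?expr0// exprn_gt0.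
have y1 : 0 < y + 1 by rewrite ltr_wpDl.
rewrite /stirling_step E0 E1 E2 E3 -/y.
rewrite ler_pdivrMr; last by rewrite mulr_gt0// ltr_wpDl// mulr_ge0.
rewrite mulrAC ler_pdivlMr; last by rewrite mulr_gt0 ?exprn_gt0// ltr_wpDl// mulr_ge0.
have {}HP : P * (M ^+ k) <= y ^+ k * (y + 2) ^+ k.
  move: HP; rewrite expr_div_n exprMn ler_pdivlMr ?exprn_gt0//.
have {}HP : M ^+ k * (M * (2 * y + 3)) <=
    y ^+ k * (y + 2) ^+ k * ((y + 2) ^+ 2 * (2 * y + 1)).
  have Q0 : 0 <= (y + 2) ^+ 2 * (2 * y + 1).
    by rewrite mulr_ge0 ?exprn_ge0 ?addr_ge0 ?mulr_ge0.
  apply: le_trans (ler_wpM2r Q0 HP).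
  by rewrite [leRHS]mulrAC [leRHS]mulrC ler_pM2l ?exprn_gt0.
have M2 : M ^+ k = (y + 1) ^+ k * (y + 1) ^+ k by rewrite /M expr2 exprMn.
move: HP; rewrite M2 /M -(ler_pM2l (_ : 0 < 2 :> R))//.
by rewrite !exprS; congr (_ <= _); ring.
Qed.

(** The right side divided by the left is [stirling_step (k + j).+1 / stirling_step k]. *)
Lemma stirling_ratio_spread k j :
  stirling_ratio k.+1 * stirling_ratio (k.+1 + j) <=
  stirling_ratio k * stirling_ratio (k.+2 + j).
Proof.
have mono i : stirling_step k <= stirling_step (k + i).
  by elim: i => [|i IH]; rewrite ?addn0// addnS (le_trans IH)// stirling_step_mono.
have a1 : (k.+1 + j = (k + j).+1)%N by [].
have a2 : (k.+2 + j = (k + j).+2)%N by [].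
rewrite a1 a2 (stirling_ratioS (k + j).+1) (stirling_ratioS k).
have g0 := @stirling_ratio_gt0.
rewrite [leRHS]mulrA (ler_wpM2r (ltW (g0 _)))// mulrC (ler_wpM2l (ltW (g0 _)))//.
by rewrite -addnS mono.
Qed.

Lemma sqrt_wallis_le1 k m : (m <= k.*2.+1)%N -> Num.sqrt m%:R * wallis k <= 1.
Proof.
move=> mk; have w0 := ltW (wallis_gt0 k).
rewrite -(@ler_sqr R) ?nnegrE ?mulr_ge0 ?sqrtr_ge0//.
rewrite exprMn sqr_sqrtr// expr1n mulrC; apply: le_trans (wallis_sqr k).
by rewrite ler_wpM2l ?sqr_ge0// ler_nat.
Qed.

Lemma bernoulli1 (x : R) k : 0 <= x <= 1 -> 1 - k%:R * x <= (1 - x) ^+ k.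
Proof.
move=> /andP[x0 x1]; elim: k => [|k IH]; first by rewrite mul0r subr0.
rewrite [leRHS]exprS; apply: le_trans (ler_wpM2l _ IH); last by rewrite subr_ge0.
have k0 : 0 <= k%:R :> R by [].
have := mulr_ge0 k0 (sqr_ge0 x); rewrite -natr1; nra.
Qed.

(** The two sides differ exactly by the factor [sqrt (2k) * wallis k], which is at most 1. *)
Lemma stirling_ratio_even k : (0 < k)%N ->
  Num.sqrt k.*2%:R * (k.*2%:R ^+ k.*2 / (k.*2)`!%:R) <=
  stirling_ratio k * stirling_ratio k.
Proof.
move=> k0; have w0 := wallis_gt0 k.
have f0 : k`!%:R != 0 :> R by rewrite pnatr_eq0 -lt0n fact_gt0.
have -> : k.*2%:R ^+ k.*2 = 4 ^+ k * (k%:R ^+ k * k%:R ^+ k) :> R.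
  rewrite -mul2n exprM natrM (_ : (2 * k%:R) ^+ 2 = 4 * (k%:R * k%:R)); last by ring.
  by rewrite !exprMn.
rewrite -wallis_fact.
have -> : 4 ^+ k * (k%:R ^+ k * k%:R ^+ k) / (wallis k * (4 ^+ k * k`!%:R ^+ 2)) =
    stirling_ratio k * stirling_ratio k * wallis k.
  by rewrite /stirling_ratio; field; rewrite f0 gt_eqF//= expf_neq0.
have g0 := stirling_ratio_gt0 k.
rewrite mulrCA; apply: ler_piMr; first exact: (ltW (mulr_gt0 g0 g0)).
exact: sqrt_wallis_le1.
Qed.

Lemma stirling_ratio_odd k :
  Num.sqrt k.*2.+1%:R * (k.*2.+1%:R ^+ k.*2.+1 / (k.*2.+1)`!%:R) <=
  stirling_ratio k * stirling_ratio k.+1.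
Proof.
have w0 := wallis_gt0 k.
have f0 : k`!%:R != 0 :> R by rewrite pnatr_eq0 -lt0n fact_gt0.
pose y : R := k%:R; have y0 : 0 <= y by [].
have E0 : k.*2.+1%:R = 2 * y + 1 :> R by rewrite -natr1 -muln2 natrM mulrC.
have E2 : k.+1%:R = y + 1 :> R by rewrite -natr1.
have N0 : 0 < 2 * y + 1 by rewrite ltr_wpDl// mulr_ge0.
pose N := (2 * y + 1) ^+ 2; have NN0 : 0 < N by rewrite exprn_gt0.
have N1 : 1 <= N by rewrite expr_ge1 ?(ltW N0)// lerDr mulr_ge0.
have kk : 0 < y ^+ k by rewrite /y; case: (k) => [|i]; rewrite ?expr0// exprn_gt0.
(* Here the first-order Bernoulli inequality suffices, since
   [1 - N^-1 = 4 k (k + 1) / (2k + 1)^2]. *)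
have main : (2 * y + 1) * N ^+ k <= 2 * (y + 1) ^+ k.+1 * y ^+ k * 4 ^+ k.
  have : 1 - y * N^-1 <= (1 - N^-1) ^+ k.
    by apply: bernoulli1; rewrite invr_ge0 (ltW NN0) invf_le1.
  have -> : 1 - N^-1 = 4 * y * (y + 1) / N by rewrite /N; field; rewrite gt_eqF.
  rewrite expr_div_n ler_pdivlMr ?exprn_gt0// => h.
  have -> : 2 * (y + 1) ^+ k.+1 * y ^+ k * 4 ^+ k = (2 * y + 2) * (4 * y * (y + 1)) ^+ k.
    by rewrite exprS !exprMn; ring.
  apply: le_trans (ler_wpM2l _ h); last by rewrite addr_ge0 ?mulr_ge0.
  rewrite [leRHS]mulrA (ler_wpM2r (exprn_ge0 k (ltW NN0)))// -subr_ge0.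
  have -> : (2 * y + 2) * (1 - y / N) - (2 * y + 1) = (2 * y ^+ 2 + 2 * y + 1) / N.
    by rewrite /N; field; rewrite gt_eqF.
  by rewrite (divr_ge0 _ (ltW NN0))// !addr_ge0 ?mulr_ge0 ?exprn_ge0.
rewrite factS natrM -wallis_fact stirling_ratioS mulrCA /stirling_step E0 E2 -/y.
have -> : (2 * y + 1) ^+ k.*2.+1 = (2 * y + 1) * N ^+ k.
  by rewrite exprS -mul2n exprM.
rewrite [leRHS](_ : _ = (2 * (y + 1) ^+ k.+1 * y ^+ k * 4 ^+ k) *
   ((2 * y + 1) * (wallis k * (4 ^+ k * k`!%:R ^+ 2)))^-1 * (wallis k)^-1); last first.
  rewrite /stirling_ratio -/y; field.
  by rewrite f0 !gt_eqF//= exprn_gt0.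
have D0 : 0 <= ((2 * y + 1) * (wallis k * (4 ^+ k * k`!%:R ^+ 2)))^-1.
  by rewrite invr_ge0 (mulr_ge0 (ltW N0))// (mulr_ge0 (ltW w0))// mulr_ge0 ?exprn_ge0.
rewrite mulrCA mulrA [leRHS]mulrAC; apply: ler_wpM2r => //.
rewrite ler_pdivlMr// mulrAC; apply: le_trans main; apply: ler_piMl.
  by rewrite (mulr_ge0 (ltW N0))// exprn_ge0// ltW.
by have := @sqrt_wallis_le1 k _ (leqnn _); rewrite E0.
Qed.

Lemma stirling_ratio_mul k l : (0 < k + l)%N ->
  Num.sqrt (k + l)%:R * ((k + l)%:R ^+ (k + l) / (k + l)`!%:R) <=
  stirling_ratio k * stirling_ratio l.
Proof.
wlog kl : k l / (k <= l)%N.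
  move=> H; have [/H//|/ltnW lk] := leqP k l.
  by rewrite addnC [leRHS]mulrC; exact: H.
rewrite -(subnKC kl); move: (l - k)%N => {l kl} j.
(* The gap [j] shrinks by two as both indices move one unit towards each other, ending at an even or
   an odd central case. *)
elim/ltn_ind: j k => -[|[|j]] IH k kl0.
- by rewrite addn0 addnn in kl0 *; rewrite stirling_ratio_even//; lia.
- by rewrite addn1 addnS addnn stirling_ratio_odd.
have := IH j (ltnW (ltnSn _)) k.+1; rewrite (_ : k.+1 + (k.+1 + j) = k + (k + j.+2))%N; last lia.
move=> /(_ kl0) /le_trans; apply.
by have := stirling_ratio_spread k j; rewrite (_ : k.+2 + j = k + j.+2)%N//; lia.
Qed.

Lemma binomial_mass_ge k l : (0 < k + l)%N ->
  Num.sqrt (k + l)%:R * (wallis k * wallis l) <=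
  'C(k + l, k)%:R * (k%:R ^+ k * l%:R ^+ l / (k + l)%:R ^+ (k + l)).
Proof.
move=> kl0; have := stirling_ratio_mul kl0.
have wk := wallis_gt0 k; have wl := wallis_gt0 l.
have fk : 0 < k`!%:R :> R by rewrite ltr0n fact_gt0.
have fl : 0 < l`!%:R :> R by rewrite ltr0n fact_gt0.
have fn : 0 < (k + l)`!%:R :> R by rewrite ltr0n fact_gt0.
have nn : 0 < (k + l)%:R ^+ (k + l) :> R by rewrite exprn_gt0// ltr0n.
have -> : 'C(k + l, k)%:R = (k + l)`!%:R / (k`!%:R * l`!%:R) :> R.
  apply: (canRL (mulfK _)); first by rewrite mulf_neq0 ?gt_eqF.
  by rewrite -!natrM -(bin_fact (leq_addr l k)) addKn.
move=> /(ler_wpM2r (_ : 0 <= wallis k * wallis l * ((k + l)`!%:R / (k + l)%:R ^+ (k + l)))).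
move=> /(_ (ltW _)) H.
have {}H := H (mulr_gt0 (mulr_gt0 wk wl) (divr_gt0 fn nn)).
apply: le_trans (le_trans H _); rewrite le_eqVlt; apply/orP/or_introl/eqP.
  by field; rewrite !gt_eqF.
by rewrite /stirling_ratio; field; rewrite !gt_eqF.
Qed.

End central_binomial.

(** * The one-dimensional sum *)

Section one_dimension.
Context {R : realType} {m : nat}.
Implicit Types (c : 'I_m -> R) (f : {ffun 'I_m -> bool}).

Definition likelihood1 c f (s : R) : R :=
  \prod_a sigmoid ((-1) ^+ f a * (c a * s)).

Lemma likelihood1_gt0 c f s : 0 < likelihood1 c f s.
Proof. by apply: prodr_gt0 => a _; exact: sigmoid_gt0. Qed.

Import numFieldNormedType.Exports.

(** As [f (- s) = m - f s] and [f T >= m - 1] for some [T], continuity yields every value in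
    [[1, m - 1]]. *)
Lemma exists_mean c k : (forall a, 0 < c a) -> (0 < k < m)%N ->
  exists s, \sum_a sigmoid (c a * s) = k%:R.
Proof.
move=> c0 /andP[k0 km].
pose f s := \sum_a sigmoid (c a * s).
have fN s : f (- s) = m%:R - f s.
  have -> : m%:R = \sum_(a < m) 1 :> R by rewrite sumr_const card_ord.
  rewrite -sumrB.
  by apply: eq_bigr => a _; rewrite mulrN sigmoidN.
have m0 : 0 < m%:R :> R by rewrite ltr0n; lia.
have im0 : 0 < m%:R^-1 :> R by rewrite invr_gt0.
have [T T0 /(_ T (lexx _)) HT] := prod_sigmoid_ge c0 im0.
have fT : m%:R - 1 <= f T.
  have -> : m%:R - 1 = \sum_(a < m) (1 - m%:R^-1) :> R.
    by rewrite sumr_const card_ord mulrnBl -[_^-1 *+ _]mulr_natr mulVf ?gt_eqF.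
  apply: ler_sum => a _; apply: (le_trans HT); exact: (prod_sigmoid_le (fun a => c a * T)).
have fcont : continuous f.
  rewrite /f; elim: (index_enum _) => [|a r IH] s.
    by under eq_fun do rewrite big_nil; exact: cst_continuous.
  under eq_fun do rewrite big_cons.
  apply: (@continuousD R R^o R (fun s => sigmoid (c a * s))
    (fun s => \sum_(b <- r) sigmoid (c b * s)) s); last exact: IH.
  apply: (@continuous_comp _ _ _ (fun s : R => c a * s) (fun t : R => sigmoid t)).
    exact: mulrl_continuous.
  exact: continuous_sigmoid.
have TT : - T <= T by rewrite ge0_cp// ltW.
have kR : 1 <= k%:R :> R by rewrite ler1n.
have kmR : k%:R <= m%:R - 1 :> R by rewrite lerBrDr natr1 ler_nat.
have [|s _ fs] := @IVT R f (- T) T k%:R TT (continuous_subspaceT fcont).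
  rewrite fN ge_min le_max; apply/andP; split; apply/orP.
    by left; lra.
  by right; lra.
by exists s.
Qed.

Definition weight f : nat := \sum_a f a.

Lemma weight_le f : (weight f <= m)%N.
Proof.
apply: (@leq_trans (\sum_(a < m) 1)); last by rewrite sum1_card card_ord.
by apply: leq_sum => a _; case: (f a).
Qed.

(** Expanding the product picks a sign for each index, and the degree in [X] counts the minus
    signs. *)
Lemma sum_likelihood1_weight c k s :
  \sum_(f | weight f == k) likelihood1 c f s =
  (bernoulli_sum_poly [seq 1 - sigmoid (c a * s) | a <- index_enum 'I_m])`_k.
Proof.
rewrite /bernoulli_sum_poly big_map.
pose F a (b : bool) : {poly R} :=
  (sigmoid ((-1) ^+ b * (c a * s)))%:P * 'X^b.
rewrite (eq_bigr (fun a => \sum_(b : bool) F a b)); last first.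
  move=> a _; rewrite big_bool /F !sigmoid_sign expr1 expr0 mulr1 addrC.
  by rewrite mul_polyC subKr.
rewrite bigA_distr_bigA coef_sum big_mkcond/=; apply: eq_bigr => f _.
rewrite /F big_split/= -rmorph_prod/= prodrXr coefCM coefXn -/(weight f) eq_sym.
by case: ifP => _; rewrite ?mulr1 ?mulr0.
Qed.

(** For [0 < k < m] the parameter makes [m - k] plus signs expected. For [k = 0] or [k = m] no
    finite parameter has the right mean, but a single pattern suffices. *)
Lemma weight_class_ge c (k : 'I_m.+1) : (0 < m)%N -> (forall a, 0 < c a) ->
  exists s, Num.sqrt m%:R * (wallis k * wallis (m - k)) <=
    \sum_(f | weight f == k) likelihood1 c f s.
Proof.
move=> m0 c0.
have extreme (b : bool) : exists s, Num.sqrt m%:R * wallis m <=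
    \sum_(f | weight f == (if b then m else 0)%N) likelihood1 c f s.
  (* Likelihood 3/4 is enough, as [m * wallis m ^+ 2 <= m / (2m + 1) < 9 / 16]. *)
  have q0 : 0 < 4^-1 :> R by lra.
  have [T _ /(_ T (lexx _)) HT] := prod_sigmoid_ge c0 q0.
  exists ((-1) ^+ b * T); rewrite (bigD1 [ffun=> b])/=; last first.
    rewrite /weight; under eq_bigr do rewrite ffunE.
    by rewrite sum_nat_const card_ord; case: b; rewrite ?muln1 ?muln0.
  apply: ler_wpDr; first by apply: sumr_ge0 => f _; rewrite ltW ?likelihood1_gt0.
  rewrite /likelihood1; under eq_bigr do
    rewrite ffunE mulrCA signrMK.
  apply: le_trans HT.
  rewrite -(@ler_sqr R) ?nnegrE ?mulr_ge0 ?sqrtr_ge0 ?ltW ?wallis_gt0//; last by lra.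
  rewrite exprMn sqr_sqrtr//.
  have := @wallis_sqr R m; rewrite -natr1 -muln2 natrM => h.
  have := sqr_ge0 (wallis m : R); nra.
have [k0|k0] := posnP k.
  have [s Hs] := extreme false; exists s.
  by rewrite k0 subn0 mul1r.
have [km|km] := ltnP k m; last first.
  have [s Hs] := extreme true; exists s.
  have -> : k = m :> nat by apply/eqP; rewrite eqn_leq km -ltnS ltn_ord.
  by rewrite subnn mulr1.
have kmk : (0 < m - k < m)%N by lia.
have [s Hs] := exists_mean c0 kmk.
exists s; rewrite sum_likelihood1_weight.
have kl : (k + (m - k))%N = m by rewrite subnKC// ltnW.
have := @binomial_mass_ge R k (m - k); rewrite kl => /(_ m0) /le_trans; apply.
have := @mass_at_mean R [seq 1 - sigmoid (c a * s) | a <- index_enum 'I_m] k (m - k).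
rewrite kl; apply=> //.
- by move=> _ /mapP[a _ ->]; rewrite subr_gt0 sigmoid_lt1/= gtrBl sigmoid_gt0.
- by rewrite subn_gt0.
- by rewrite size_map -sum1_size sum_nat_const card_ord muln1.
- by rewrite big_map sumrB Hs sumr_const card_ord natrB ?subKr// ltnW.
Qed.

(** The parameter depends on [f] only through its weight, and the bounds for the weight classes add
    up by [wallis_conv]. *)
Lemma one_dim_lower_pos c : (0 < m)%N -> (forall a, 0 < c a) ->
  exists s, Num.sqrt m%:R <= \sum_f likelihood1 c f (s f).
Proof.
move=> m0 c0.
have /choice[t Ht] (k : 'I_m.+1) := weight_class_ge k m0 c0.
exists (fun f => t (inord (weight f))).
rewrite (partition_big (fun f => inord (weight f) : 'I_m.+1) predT)//=.
have -> : Num.sqrt m%:R = \sum_(k < m.+1) Num.sqrt m%:R * (wallis k * wallis (m - k)) :> R.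
  by rewrite -mulr_sumr wallis_conv mulr1.
apply: ler_sum => k _.
apply: (le_trans (Ht k)); rewrite le_eqVlt; apply/orP/or_introl/eqP.
have E f : (inord (weight f) == k) = (weight f == k).
  by rewrite -val_eqE/= inordK// ltnS weight_le.
rewrite [RHS](eq_bigl _ _ E); apply: eq_bigr => f /eqP fk.
by rewrite fk inord_val.
Qed.

(** The signs of [c] are absorbed into the pattern by a bijection. *)
Lemma one_dim_lower c : (0 < m)%N -> (forall a, c a != 0) ->
  exists s, Num.sqrt m%:R <= \sum_f likelihood1 c f (s f).
Proof.
move=> m0 c0.
have [|s Hs] := @one_dim_lower_pos (fun a => `|c a|) m0.
  by move=> a; rewrite normr_gt0.
pose flip f := [ffun a => f a (+) (c a < 0)].
have flipK : involutive flip by move=> f; apply/ffunP => a; rewrite !ffunE addbK.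
exists (s \o flip); rewrite (reindex_inj (can_inj flipK)).
apply: (le_trans Hs); rewrite le_eqVlt; apply/orP/or_introl/eqP.
apply: eq_bigr => f _; rewrite /= flipK; apply: eq_bigr => a _.
by rewrite ffunE signr_addb normrEsign !mulrA.
Qed.

End one_dimension.

(* Adding one coordinate of much larger scale to c: every pattern f persists with
   the new sign that agrees with s f, and the 2^m patterns with the other sign are
   reached near s = 0, where each has likelihood about 2^-m. *)
Lemma one_dim_lacunary (R : realType) (m : nat) (C : R) : 0 <= C < m.+1%:R ->
  exists c : 'I_m -> R, exists s : {ffun 'I_m -> bool} -> R,
    [/\ forall a, 0 < c a, forall f, s f != 0 &
        C <= \sum_f likelihood1 c f (s f)].
Proof.
elim: m C => [|m IH] C /andP[C0 Cm].
  exists (fun=> 1), (fun=> 1); split=> [//|f|]; first exact: oner_neq0.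
  rewrite (bigD1 [ffun=> false])//= /likelihood1 big_ord0.
  apply: ler_wpDr; last exact: ltW.
  by apply: sumr_ge0 => f _; rewrite big_ord0.
pose y : R := m%:R; have y0 : 0 <= y by [].
have E1 : m.+1%:R = y + 1 :> R by rewrite -natr1.
have E2 : m.+2%:R = y + 2 :> R by rewrite -natr1 E1; ring.
rewrite E2 in Cm.
(* With this value the final bound [(1 - eta) (y + 1 - eta) + (1 - eta)^2] equals [C + 2 eta^2]. *)
pose eta := (y + 2 - C) / (y + 4).
have y4 : 0 < y + 4 by rewrite ltr_wpDl.
have eta0 : 0 < eta by rewrite divr_gt0// subr_gt0.
have eta1 : eta < 1 by rewrite ltr_pdivrMr//; lra.
have etaE : eta * (y + 4) = y + 2 - C by rewrite divfK// gt_eqF.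
have [|c [s [c0 s0 Hs]]] := IH (y + 1 - eta).
  by rewrite E1; apply/andP; split; lra.
pose sc := \sum_a c a.
have sc0 : 0 <= sc by apply: sumr_ge0 => a _; rewrite ltW.
have sc1 : 0 < 1 + sc by rewrite ltr_wpDr.
have [delta delta0 dsc] : exists2 delta, 0 < delta & sc * delta <= eta.
  exists (eta / (1 + sc)); first by rewrite divr_gt0.
  by rewrite mulrA ler_pdivrMr// mulrC ler_wpM2l ?ltW// ltrDr.
have near0 f (t : bool) : 2^-1 ^+ m * (1 - eta) <= likelihood1 c f ((-1) ^+ t * delta).
  apply: (@le_trans _ _ (\prod_a (expR (- (c a * delta)) / 2))).
    rewrite big_split/= -expR_sum prodr_const card_ord mulrC ler_wpM2r ?exprn_ge0//.
    rewrite sumrN -mulr_suml -/sc; apply: le_trans (expR_ge1Dx _).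
    by rewrite lerD2l lerN2.
  apply: ler_prod => a _; rewrite divr_ge0 ?expR_ge0//=.
  apply: le_trans (sigmoid_ge_half _).
  by rewrite normrMsign mulrCA normrMsign (gtr0_norm (mulr_gt0 (c0 a) delta0)).
(* A product over all patterns [f] yields one scale [M] for all of them; this is why [s f != 0] is
   carried along. *)
have [M M0 HM] : exists2 M, 0 < M &
    forall f, 1 - eta <= sigmoid (M * `|s f|) /\ 1 - eta <= sigmoid (M * delta).
  pose a f := Num.min `|s f| delta.
  have a0 f : 0 < a f by rewrite lt_min normr_gt0 s0.
  have [T T0 /(_ T (lexx _)) HT] := prod_sigmoid_ge a0 eta0.
  exists T => // f.
  have : 1 - eta <= sigmoid (T * a f).
    by apply: (le_trans HT); rewrite mulrC; exact: (prod_sigmoid_le (fun f => a f * T)).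
  by move=> h; split; apply: (le_trans h); rewrite le_sigmoid ler_pM2l// ge_min lexx ?orbT.
pose c' (a : 'I_m.+1) := oapp c M (unlift ord_max a).
pose ext (p : {ffun 'I_m -> bool} * bool) : {ffun 'I_m.+1 -> bool} :=
  [ffun a => oapp p.1 p.2 (unlift ord_max a)].
pose res (g : {ffun 'I_m.+1 -> bool}) : {ffun 'I_m -> bool} * bool :=
  ([ffun a => g (lift ord_max a)], g ord_max).
have extK : cancel ext res.
  move=> [f t]; rewrite /res /ext ffunE unlift_none; congr (_, _).
  by apply/ffunP => a; rewrite !ffunE liftK.
have resK : cancel res ext.
  by move=> g; apply/ffunP => a; rewrite ffunE /=; case: unliftP => [b|] -> /=;
    rewrite ?ffunE.
pose s' p : R := if p.2 == (s p.1 < 0) then s p.1 else (-1) ^+ p.2 * delta.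
exists c', (s' \o res); split.
- by move=> a; rewrite /c'; case: unlift.
- move=> g; rewrite /= /s'; case: ifP => _; first exact: s0.
  by rewrite mulf_neq0 ?signr_eq0// gt_eqF.
rewrite (reindex ext); last by exists res => ? _; [exact: extK|exact: resK].
have step f t : likelihood1 c' (ext (f, t)) ((s' \o res) (ext (f, t))) =
    sigmoid ((-1) ^+ t * (M * s' (f, t))) * likelihood1 c f (s' (f, t)).
  rewrite /= extK /likelihood1 (bigD1_ord ord_max)//= ffunE /c' unlift_none/=.
  by congr (_ * _); apply: eq_bigr => a _; rewrite ffunE liftK.
rewrite -(pair_bigA _ (fun f t => likelihood1 c' (ext (f, t)) ((s' \o res) (ext (f, t)))))/=.
apply: (@le_trans _ _ (\sum_(f : {ffun 'I_m -> bool})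
    ((1 - eta) * likelihood1 c f (s f) + (1 - eta) * (2^-1 ^+ m * (1 - eta))))).
  rewrite big_split/= -!mulr_sumr sumr_const card_ffun card_bool card_ord.
  have -> : 2^-1 ^+ m * ((1 - eta) *+ 2 ^ m) = 1 - eta.
    by rewrite -[_ *+ (2 ^ m)%N]mulr_natl natrX mulrA -exprMn mulVf// expr1n mul1r.
  nra.
apply: ler_sum => f _.
rewrite [leRHS](_ : _ = \sum_(t : bool) (sigmoid ((-1) ^+ t * (M * s' (f, t))) *
  likelihood1 c f (s' (f, t)))); last by apply: eq_bigr => t _; rewrite -step.
rewrite (bigD1 (s f < 0))//= (bigD1 (~~ (s f < 0)))/=; last by case: (s f < 0).
rewrite big_pred0 ?addr0; last by move=> t; case: t (s f < 0) => [] [].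
have [HM1 HM2] := HM f.
have e1 : 0 <= 1 - eta by lra.
rewrite /s' /= eqxx (negPf (_ : ~~ (s f < 0) != (s f < 0))); last by case: (s f < 0).
apply: lerD; apply: ler_pM => //.
- by rewrite ltW ?likelihood1_gt0.
- by apply: le_trans HM1 _; rewrite le_sigmoid mulrCA ler_pM2l// normrEsign.
- by rewrite mulr_ge0// exprn_ge0// invr_ge0.
- apply: le_trans HM2 _; rewrite le_sigmoid mulrCA ler_pM2l// mulrA -expr2 sqrr_sign.
  by rewrite mul1r.
Qed.

(* If the x_i split into d groups indexed by 'I_m along a basis with dual basis v,
   the coordinates of theta along v can be chosen independently in each group. *)
Lemma shtarkov_tensor (R : realType) (n d m : nat) (x : 'I_n -> 'rV[R]_d)
    (h : 'I_d * 'I_m -> 'I_n) (c : 'I_d -> 'I_m -> R) (v : 'I_d -> 'rV[R]_d)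
    (s : 'I_d -> {ffun 'I_m -> bool} -> R) : bijective h ->
  (forall j a k, dotp (x (h (j, a))) (v k) = if k == j then c j a else 0) ->
  \prod_j \sum_f likelihood1 (c j) f (s j f) <= logistic_shtarkov x.
Proof.
move=> [h' hK h'K] xv.
pose psi (e : {ffun 'I_n -> bool}) := [ffun j => [ffun a => e (h (j, a))]] :
  {ffun 'I_d -> {ffun 'I_m -> bool}}.
pose psi' (phi : {ffun 'I_d -> {ffun 'I_m -> bool}}) :=
  [ffun i => phi (h' i).1 (h' i).2] : {ffun 'I_n -> bool}.
have psiK : cancel psi psi'.
  by move=> e; apply/ffunP => i; rewrite !ffunE -surjective_pairing h'K.
have psi'K : cancel psi' psi.
  by move=> phi; apply/ffunP => j; apply/ffunP => a; rewrite !ffunE hK.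
pose theta e := \sum_j s j (psi e j) *: v j.
apply: le_trans (shtarkov_ge x theta).
rewrite bigA_distr_bigA (reindex psi); last by exists psi' => ? _; [exact: psiK|exact: psi'K].
rewrite le_eqVlt; apply/orP/or_introl/eqP; apply: eq_bigr => e _.
rewrite /likelihood1 pair_bigA/= /likelihood [RHS](reindex h); last first.
  by exists h' => ? _; [exact: hK|exact: h'K].
apply: eq_bigr => -[j a] _ /=; rewrite /theta dotp_sumr.
rewrite (bigD1 j)//= big1 => [|k kj]; rewrite dotpZr xv.
  by rewrite eqxx addr0 !ffunE [s _ _ * _]mulrC.
by rewrite (negPf kj) mulr0.
Qed.

(** * Configurations split into blocks along a basis *)

Lemma fibers_bijection (n d m : nat) (g : 'I_n -> 'I_d) :
  (forall j, #|[pred i | g i == j]| = m) -> n = (d * m)%N ->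
  exists2 h : 'I_d * 'I_m -> 'I_n, bijective h & forall p, g (h p) = p.1.
Proof.
move=> Hg nE.
pose h (p : 'I_d * 'I_m) := enum_val (cast_ord (esym (Hg p.1)) p.2).
have gh p : g (h p) = p.1 by have := enum_valP (cast_ord (esym (Hg p.1)) p.2) => /eqP.
exists h => //; apply: inj_card_bij; last by rewrite card_prod !card_ord nE.
move=> [j a] [k b] hh; have /= jk : (j, a).1 = (k, b).1 by rewrite -!gh hh.
by move: hh; rewrite -jk => /enum_val_inj/cast_ord_inj /= ->.
Qed.

(** The basis dual to [u] decouples the groups, each of which contributes a factor [sqrt m]. *)
Lemma shtarkov_grouped (R : realType) (n d m : nat) (x : 'I_n -> 'rV[R]_d)
    (g : 'I_n -> 'I_d) (u : 'I_d -> 'rV[R]_d) : (0 < m)%N -> n = (d * m)%N ->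
  (forall j : 'I_d, #|[pred i | g i == j]| = m) ->
  (forall i : 'I_n, exists2 c : R, c != 0 & x i = c *: u (g i)) ->
  free [seq u j | j : 'I_d] ->
  d%:R / 2 * ln m%:R <= ln (logistic_shtarkov x).
Proof.
move=> m0 nE Hg Hx ufree.
have [h hbij gh] := fibers_bijection Hg nE.
have /choice[c Hc] (i : 'I_n) : exists c, c != 0 /\ x i = c *: u (g i).
  by have [c] := Hx i; exists c.
have /choice[v Hv] (k : 'I_d) : exists v, forall j : 'I_d, dotp (u j) v = (k == j)%:R.
  have [v Hv] := dual_family (fun j : 'I_d => (k == j)%:R : R) ufree.
  by exists v => j; exact: Hv.
have /choice[s Hs] (j : 'I_d) : exists s : {ffun 'I_m -> bool} -> R,
    Num.sqrt m%:R <= \sum_f likelihood1 (fun a => c (h (j, a))) f (s f).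
  by apply: one_dim_lower => // a; case: (Hc (h (j, a))).
have H : Num.sqrt m%:R ^+ d <= logistic_shtarkov x.
  apply: (@le_trans _ _ (\prod_(j < d) \sum_f likelihood1 (fun a => c (h (j, a))) f (s j f))).
    rewrite -[X in _ ^+ X]card_ord -prodr_const; apply: ler_prod => j _.
    by rewrite sqrtr_ge0 Hs.
  apply: (shtarkov_tensor (v := v) s hbij) => j a k.
  have [_ ->] := Hc (h (j, a)); rewrite gh dotpZl Hv/=.
  by case: eqP => _; rewrite ?mulr1 ?mulr0.
have r0 : 0 < Num.sqrt m%:R :> R by rewrite sqrtr_gt0 ltr0n.
have -> : d%:R / 2 * ln m%:R = ln (Num.sqrt m%:R ^+ d) :> R.
  rewrite -[m%:R in LHS]sqr_sqrtr// !lnXn//.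
  by rewrite -mulr_natl -[RHS]mulr_natl; field.
by rewrite ler_ln ?posrE ?exprn_gt0// shtarkov_gt0.
Qed.

(** The same lacunary coefficients are placed along each standard basis vector. *)
Lemma shtarkov_sup (R : realType) (n d m : nat) (C : R) : n = (d * m)%N ->
  0 < C < m.+1%:R ->
  exists x : 'I_n -> 'rV[R]_d, d%:R * ln C <= ln (logistic_shtarkov x).
Proof.
move=> nE /andP[C0 Cm].
have [c [s [_ _ Hs]]] := @one_dim_lacunary R m C (introT andP (conj (ltW C0) Cm)).
have cardE : #|{: 'I_d * 'I_m}| = n by rewrite card_prod !card_ord.
pose h (p : 'I_d * 'I_m) := cast_ord cardE (enum_rank p).
pose h' (i : 'I_n) := enum_val (cast_ord (esym cardE) i).
have hK : cancel h h' by move=> p; rewrite /h /h' cast_ordK enum_rankK.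
have h'K : cancel h' h by move=> i; rewrite /h /h' enum_valK cast_ordKV.
pose x (i : 'I_n) : 'rV[R]_d := c (h' i).2 *: delta_mx 0 (h' i).1.
exists x; rewrite mulr_natl -lnXn// ler_ln ?posrE ?exprn_gt0 ?shtarkov_gt0//.
apply: (@le_trans _ _ (\prod_(j < d) \sum_f likelihood1 c f (s f))).
  by rewrite -[X in _ ^+ X]card_ord -prodr_const; apply: ler_prod => j _; rewrite ltW// Hs.
apply: (@shtarkov_tensor R n d m x h (fun=> c) (fun k => delta_mx 0 k) (fun=> s)).
  by exists h'.
move=> j a k; rewrite /x hK/= dotpZl /dotp (bigD1 k)//= big1 => [|l lk].
  by rewrite !mxE !eqxx addr0 mulr1 andTb; case: eqP => _; rewrite ?mulr1 ?mulr0.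
by rewrite [X in _ * X]mxE (negPf lk) andbF mulr0.
Qed.

Theorem theorem4p1 (R : realType) (n d : nat)
    (hn : (1 <= n)%N) (hd : (1 <= d)%N) :
  (* (i) *)
  ((d <= n)%N -> forall x : 'I_n -> 'rV[R]_d,
     ln (logistic_shtarkov x) <= ln (\sum_(l < d.+1) 'C(n, l))%N%:R
     /\ ln (\sum_(l < d.+1) 'C(n, l))%N%:R
          <= d%:R * ln (expR 1 * n%:R / d%:R) :> R)
  /\
  (* (ii) *)
  (((2 <= n)%N -> forall x : 'I_n -> 'rV[R]_1, (forall i, x i != 0) ->
      2^-1 * ln n%:R <= ln (logistic_shtarkov x))
   /\
   ((d %| n)%N ->
      forall (x : 'I_n -> 'rV[R]_d) (g : 'I_n -> 'I_d) (u : 'I_d -> 'rV[R]_d),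
      (forall j : 'I_d, #|[pred i | g i == j]| = (n %/ d)%N) ->
      (forall i : 'I_n, exists2 c : R, c != 0 & x i = c *: u (g i)) ->
      free [seq u j | j : 'I_d] ->
      d%:R / 2 * ln (n%:R / d%:R) <= ln (logistic_shtarkov x)))
  /\
  (* (iii) *)
  ((d %| n)%N ->
     ((d%:R * ln (n%:R / d%:R + 1))%:E
        <= ereal_sup (range (fun x' : 'I_n -> 'rV[R]_d =>
                               (ln (logistic_shtarkov x'))%:E)))%E)
  /\
  (* (iv) *)
  ((d <= n)%N -> forall x : 'I_n -> 'rV[R]_d, general_position x ->
     ln (2 * (\sum_(l < d) 'C(n - 1, l))%N%:R) <= ln (logistic_shtarkov x)
     /\ ((2 <= d)%N ->
           (d%:R - 1) * ln ((n%:R - 1) / (d%:R - 1))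
             <= ln (logistic_shtarkov x))).
Proof.
have d0 : 0 < d%:R :> R by rewrite ltr0n.
have n0 : 0 < n%:R :> R by rewrite ltr0n.
have ndE : (d %| n)%N -> n = (d * (n %/ d))%N by move=> dn; rewrite mulnC divnK.
have ndR : (d %| n)%N -> n%:R / d%:R = (n %/ d)%:R :> R.
  by move=> /ndE {1}->; rewrite natrM mulrAC divff ?mul1r// gt_eqF.
split=> [dn x|].
  have S0 : 0 < (\sum_(l < d.+1) 'C(n, l))%N%:R :> R.
    by rewrite ltr0n big_ord_recl bin0 addn_gt0.
  rewrite mulr_natl -lnXn; last by rewrite divr_gt0// mulr_gt0// expR_gt0.
  rewrite !ler_ln ?posrE ?shtarkov_gt0//; last first.
    by rewrite exprn_gt0// divr_gt0// mulr_gt0// expR_gt0.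
  by rewrite shtarkov_upper sum_binom_le// hd.
split; [split|split].
- move=> n2 x x0; rewrite -[2^-1]mul1r.
  (* In dimension one all vectors form a single group, with common vector 1. *)
  apply: (@shtarkov_grouped R n 1 n x (fun=> ord0) (fun=> const_mx 1)) => //.
  + by rewrite mul1n.
  + move=> j; rewrite -[RHS]card_ord; apply: eq_card => i; rewrite !inE.
    by rewrite [j]ord1.
  + move=> i; exists (x i 0 0).
      apply: contraNneq (x0 i) => xi; apply/eqP/rowP => k.
      by rewrite ord1 xi mxE.
    by apply/rowP => k; rewrite ord1 !mxE mulr1.
  + have -> : [seq const_mx 1 | _ : 'I_1] = [:: const_mx 1 : 'rV[R]_1].
      by rewrite /image_mem enum_ordSl/= (size0nil (size_enum_ord 0)).
    rewrite seq1_free; apply/eqP => /rowP /(_ 0); rewrite !mxE.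
    by apply/eqP/oner_neq0.
- move=> dn x g u Hg Hx ufree; rewrite ndR//.
  by apply: shtarkov_grouped Hg Hx ufree; [rewrite divn_gt0// dvdn_leq|exact: ndE].
- move=> dn; rewrite ndR// natr1; set m := (n %/ d)%N.
  apply/lee_addgt0Pr => eps eps0.
  have m0 : 0 < m.+1%:R :> R by [].
  (* For this [C], [d ln C = d ln (m + 1) - eps]. *)
  have [|x Hx] := @shtarkov_sup R n d m (m.+1%:R * expR (- (eps / d%:R))) (ndE dn).
    rewrite mulr_gt0 ?expR_gt0//= -[ltRHS]mulr1 ltr_pM2l//.
    by rewrite -[ltRHS]expR0 ltr_expR oppr_lt0 divr_gt0.
  apply: (@le_trans _ _ ((ln (logistic_shtarkov x))%:E + eps%:E)%E); last first.
    by rewrite leeD2r//; apply: ereal_sup_ubound; exists x.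
  rewrite -EFinD lee_fin -lerBlDr; apply: le_trans Hx.
  rewrite lnM ?posrE ?expR_gt0// expRK mulrDr mulrN mulrCA divff ?mulr1// gt_eqF//.
- move=> dn x gp.
  have i0 : 'I_n by exists 0%N.
  have N0 : (0 < \sum_(l < d) 'C(n - 1, l))%N.
    by rewrite -(prednK hd) big_ord_recl bin0 addn_gt0.
  have H : 2 * (\sum_(l < d) 'C(n - 1, l))%N%:R <= logistic_shtarkov x.
    apply: le_trans (shtarkov_ge_realizable x).
    by rewrite -natrM ler_nat mulnC card_realizable.
  have H1 : ln (2 * (\sum_(l < d) 'C(n - 1, l))%N%:R) <= ln (logistic_shtarkov x).
    by rewrite ler_ln ?posrE ?shtarkov_gt0// mulr_gt0// ltr0n.
  split=> // d2; apply: le_trans H1.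
  have dR : (d - 1)%:R = d%:R - 1 :> R by rewrite natrB.
  have nR : (n - 1)%:R = n%:R - 1 :> R by rewrite natrB.
  have d1 : 0 < (d - 1)%:R :> R by rewrite ltr0n subn_gt0.
  have n1 : 0 < (n - 1)%:R :> R by rewrite ltr0n subn_gt0; exact: leq_trans dn.
  rewrite -dR -nR [leLHS]mulr_natl -lnXn ?divr_gt0//.
  rewrite ler_ln ?posrE ?exprn_gt0 ?divr_gt0//; last by rewrite mulr_gt0// ltr0n.
  rewrite expr_div_n ler_pdivrMr ?exprn_gt0// -!natrX -!natrM ler_nat.
  apply: leq_trans (expn_le_binom (leq_sub2r 1 dn)) _.
  rewrite leq_mul2r; apply/orP; right.
  have dd : (d - 1 < d)%N by rewrite subn1 prednK.
  (* Only the term [l = d - 1] is kept, and the factor 2 is dropped. *)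
  rewrite (bigD1 (Ordinal dd))//= mulnDr.
  by rewrite (leq_trans _ (leq_addr _ _))// leq_pmull.
Qed.
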